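(* Let $f_\chi(t):=\sup_{\varphi\in\mathcal F}\xi(\varphi,t)$ and $f_\omega(t):=\xi(\mathbf 1_{B(0;1/2)},t)$ for $t\in(0,\infty)$. 1. If $\delta=1$ then $f_\chi(t)=f_\omega(t)$ for all $t\in(0,\infty)$. 2. If $\delta<1$ then there exists a constant $0<t_0<\infty$ such that $f_\chi(t)=f_\omega(t)$ for all $t\le t_0$, and the ratio $f_\chi(t)/f_\omega(t)$ is continuous and strictly increasing for $t\ge t_0$.
   Context: $d\ge1$ fixed, $\|\cdot\|$ a fixed norm on $\mathbb R^d$, $B=\{x:\|x\|<1\}$, $B(x;\rho)=\{y:\|x-y\|<\rho\}$, $\mathrm{vol}$ Lebesgue measure. Packing density: for $K>0$ let $N(K)$ be the maximum number of pairwise disjoint translates of $B$ with centres in $(0,K)^d$, and $\delta:=\lim_{K\to\infty}N(K)\mathrm{vol}(B)/K^d$. Weighted integral: $H(x)=x\ln x-x+1$. For nonnegative bounded measurable $\varphi$ with $0<\int\varphi<\infty$ and $0<t<\infty$, $s=s(\varphi,t)$ is the unique $s\ge0$ with $\int H(e^{s\varphi(x)})dx=1/t$, and $\xi(\varphi,t):=\int\varphi e^{s\varphi}$; $\xi(\varphi,\infty):=\int\varphi$; $\xi(\varphi,t)=0$ if $\int\varphi=0$. A set $S$ is well-spread if $\|v-w\|>1$ for distinct $v,w\in S$; a nonnegative measurable $\varphi$ is feasible if $\sum_{v\in S}\varphi(v)\le1$ for every well-spread $S$; $\mathcal F$ is the set of feasible functions. *)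

(* Defs.v *)
From HB Require Import structures.
From mathcomp Require Import all_boot all_order all_algebra.
From mathcomp Require Import all_classical all_reals all_analysis.
Set Implicit Arguments. Unset Strict Implicit. Unset Printing Implicit Defensive.
Import Order.TTheory GRing.Theory Num.Theory.
Import numFieldNormedType.Exports.
Local Open Scope classical_set_scope.
Local Open Scope ring_scope.

Section Defs.
Variables (R : realType) (d : nat).

(* Points of R^d are d-tuples of reals (these carry the product = Borel
   sigma-algebra of MathComp-Analysis). *)
Definition vadd (x y : d.-tuple R) : d.-tuple R :=
  [tuple tnth x i + tnth y i | i < d].
Definition vsub (x y : d.-tuple R) : d.-tuple R :=
  [tuple tnth x i - tnth y i | i < d].
Definition vscale (a : R) (x : d.-tuple R) : d.-tuple R :=
  [tuple a * tnth x i | i < d].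
Definition vzero : d.-tuple R := [tuple 0 | i < d].

Definition is_norm (N : d.-tuple R -> R) : Prop :=
  [/\ (forall x, N x = 0 -> x = vzero),
      (forall a x, N (vscale a x) = `|a| * N x) &
      (forall x y, N (vadd x y) <= N x + N y)].

Definition nball (N : d.-tuple R -> R) (x : d.-tuple R) (rho : R)
  : set (d.-tuple R) := [set y | N (vsub x y) < rho].
Definition unitB (N : d.-tuple R -> R) := nball N vzero 1.

End Defs.

(* Lebesgue integral over R^d of a nonnegative function, defined as the
   iterated one-dimensional Lebesgue integral (Fubini--Tonelli). *)
Fixpoint iint {R : realType} (d : nat) : (d.-tuple R -> \bar R) -> \bar R :=
  match d with
  | 0 => fun f => f [tuple]
  | d'.+1 => fun f =>
      (\int[@lebesgue_measure R]_x iint (fun t : d'.-tuple R => f [tuple of x :: t]))%E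
  end.

Section Defs2.
Variables (R : realType) (d : nat) (N : d.-tuple R -> R).

Definition vol (A : set (d.-tuple R)) : \bar R := iint (fun x => (\1_A x)%:E).

Definition translate (c : d.-tuple R) (A : set (d.-tuple R)) :=
  [set vadd c b | b in A].
Definition admissible_packing (K : R) (S : seq (d.-tuple R)) : Prop :=
  uniq S /\
  (forall c, c \in S -> forall i : 'I_d, 0 < tnth c i < K) /\
  {in S &, forall c c', c != c' ->
     translate c (unitB N) `&` translate c' (unitB N) = set0}.
Definition packnum (K : R) : \bar R :=
  ereal_sup [set (size S)%:R%:E | S in admissible_packing K].
Definition pack_ratio (K : R) : \bar R :=
  (packnum K * vol (unitB N) * ((K ^+ d)^-1)%:E)%E.

Definition Hf (x : R) : R := x * ln x - x + 1.

Definition integ (phi : d.-tuple R -> R) : \bar R := iint (fun x => (phi x)%:E).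

(* s(phi,t): the unique s >= 0 with int H(e^{s phi}) = 1/t *)
Definition s_par (phi : d.-tuple R -> R) (t : R) : R :=
  xget 0 [set s | 0 <= s /\
     integ (fun x => Hf (expR (s * phi x))) = (t^-1)%:E].

Definition xi (phi : d.-tuple R -> R) (t : R) : \bar R :=
  if integ phi == 0%E then 0%E
  else integ (fun x => phi x * expR (s_par phi t * phi x)).

Definition well_spread (S : set (d.-tuple R)) : Prop :=
  forall v w, S v -> S w -> v <> w -> 1 < N (vsub v w).

Definition feasible (phi : d.-tuple R -> R) : Prop :=
  measurable_fun setT phi /\ (forall x, 0 <= phi x) /\
  forall S, well_spread S -> (\esum_(v in S) (phi v)%:E <= 1)%E.

Definition f_chi (t : R) : \bar R := ereal_sup [set xi phi t | phi in feasible].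
Definition f_omega (t : R) : \bar R :=
  xi (\1_(nball N (vzero R d) (2^-1))) t.

End Defs2.

(* Main.v *)
(** Put [Phi phi s] for the integral of [exp (s * phi) - 1].  By convex duality (Young's
    inequality for [Hf]) one has [xi phi t = min_(s > 0) (1 / t + Phi phi s) / s], the minimum
    being attained at [s_par phi t]; for the indicator of a set of volume [W] the value is
    [W * exp p], where [W * Hf (exp p) = 1 / t].

    Averaging a feasible [phi] over the translates of a packing gives [integral phi <= v / delta],
    where [v] is the volume of [B(0; 1/2)].  As [exp (s * phi) - 1 <= phi * (exp s - 1)], the case
    [delta = 1] follows.

    For small [t], i.e. large [s], the level sets [{phi > a}] and [{phi > 1 - a}] are at distance
    at most 1 from each other, so by Prekopa-Leindler the product of their volumes is at most
    [v ^ 2].  Integrated over [a] in [(0, 1/2)], and combined with the bound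
    [C * (1 - max phi)] for the mass of [phi] far from its maximum, this yields
    [Phi phi s <= v * (exp s - 1)] for one [s] valid for all feasible [phi].

    Since [Phi phi s / (exp s - 1)] is nonincreasing in [s], [xi phi] can cross the curve of an
    indicator of volume [W] only upwards as [t] grows.  So if [f_chi t1] is the value for volume
    [W > v], then [f_chi t2] is at least the value for [W] when [t2 > t1], and log-concavity of
    [Hf \o exp] shows that the ratio of the curves for [W] and [v] is strictly increasing.
    Finally [f_chi] and [1 / (t * f_chi)] are nonincreasing in [t], hence continuity. *)
Require Import Defs.
From HB Require Import structures.
From mathcomp Require Import all_boot all_order all_algebra.
From mathcomp Require Import all_classical all_reals all_analysis.
From mathcomp Require Import measurable_realfun simple_functions.
From mathcomp Require Import ring lra.
Import Order.TTheory GRing.Theory Num.Theory.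
Import numFieldNormedType.Exports.
Set Implicit Arguments. Unset Strict Implicit. Unset Printing Implicit Defensive.
Local Open Scope classical_set_scope.
Local Open Scope ring_scope.

(** * Lebesgue measure on tuples *)

(** The delicate point is one [s] for all feasible [phi]. The product inequality for the volumes of
    [{phi > a}] and [{phi > 1 - a}] says nothing when the second set is null, and the first may then
    be large. So the lower level sets are cut to a closed unit ball around a near-maximum [x0] of
    [phi], where they have volume at most [2 ^ d * v]; a weight of order [2 ^ d] on the part of
    [phi] above 1/2 then controls them. The mass that is cut off is small when [phi x0] is near 1;
    when it is not, the part above 1/2 is itself small compared with that of the half ball, and a
    further weight of order [C / v] on it pays for the loss.

    Another obstacle is that the supremum in [f_chi] need not be attained. Comparisons with the
    indicator curve of volume [W] through a value of [f_chi] are therefore made for volumes [U < W],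
    where some feasible function lies above the curve, before [U] tends to [W].

    Two values of [xi] are always compared by testing one minimum problem at the minimiser of the
    other, so limits of [xi] in [phi] never have to be taken. *)

Section tuple_measure.
Context {R : realType}.

Definition vcons (d : nat) (p : R * d.-tuple R) : d.+1.-tuple R :=
  [tuple of p.1 :: p.2].
Definition vuncons (d : nat) (x : d.+1.-tuple R) : R * d.-tuple R :=
  (thead x, [tuple of behead x]).

Lemma measurable_vcons d : measurable_fun [set: R * d.-tuple R] (@vcons d).
Proof.
by apply: measurable_cons; [exact: measurable_fst | exact: measurable_snd].
Qed.

Lemma measurable_vuncons d : measurable_fun setT (@vuncons d).
Proof.
apply/measurable_fun_pair; last exact: measurable_behead.
exact: (measurable_tnth ord0).
Qed.

Lemma vconsK d : cancel (@vcons d) (@vuncons d).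
Proof. by case=> a t; congr pair; apply/val_inj. Qed.

Lemma measurable_slice d (f : d.+1.-tuple R -> \bar R) (x : R) :
  measurable_fun setT f ->
  measurable_fun setT (fun t : d.-tuple R => f [tuple of x :: t]).
Proof.
move=> mf; have mc : measurable_fun setT
    (fun t : d.-tuple R => [the d.+1.-tuple R of x :: t]).
  exact: (@measurable_cons _ _ _ _ (fun=> x) d id).
exact: (measurableT_comp mf mc).
Qed.

Section product_with_line.
Context d (mu : {sigma_finite_measure set (d.-tuple R) -> \bar R}).

Let m := pushforward (@lebesgue_measure R \x mu)%E (@vcons d).

Let m0 : m set0 = 0%E.
Proof. by rewrite /m /pushforward preimage_set0 measure0. Qed.

Let m_ge0 A : (0 <= m A)%E.
Proof. by rewrite /m /pushforward; apply: measure_ge0. Qed.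

Let m_sigma_additive : semi_sigma_additive m.
Proof.
move=> F mF tF mUF; rewrite /m /pushforward preimage_bigcup.
apply: measure_semi_sigma_additive.
- by move=> n; rewrite -[X in measurable X]setTI; exact: measurable_vcons.
- apply/trivIsetP => /= i j _ _ ij; rewrite -preimage_setI.
  by move/trivIsetP : tF => /(_ _ _ _ _ ij) ->//; rewrite preimage_set0.
- by rewrite -preimage_bigcup -[X in measurable X]setTI; exact: measurable_vcons.
Qed.

Definition mconsR : set (d.+1.-tuple R) -> \bar R := m.

HB.instance Definition _ := isMeasure.Build _ _ _ mconsR
  m0 m_ge0 m_sigma_additive.

Let mconsR_sigma_finite : sigma_finite setT mconsR.
Proof.
have /sigma_finiteP[F [TF ndF Foo]] := sigma_finiteT (@lebesgue_measure R).
have /sigma_finiteP[G [TG ndG Goo]] := sigma_finiteT mu.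
exists (fun n => @vuncons d @^-1` (F n `*` G n)).
  rewrite -preimage_bigcup (_ : \bigcup_n _ = setT) ?preimage_setT//.
  rewrite -subTset => -[x y] _.
  have [n _ Fnx] : (\bigcup_i F i) x by rewrite -TF.
  have [k _ Gky] : (\bigcup_i G i) y by rewrite -TG.
  exists (maxn n k) => //; split.
    by move: x Fnx; exact/subsetPset/ndF/leq_maxl.
  by move: y Gky; exact/subsetPset/ndG/leq_maxr.
move=> n; have [mF Fn] := Foo n; have [mG Gn] := Goo n; split.
  rewrite -[X in measurable X]setTI; apply: measurable_vuncons => //.
  exact: measurableX.
rewrite /mconsR /m /pushforward -comp_preimage (_ : _ \o _ = id); last first.
  by apply/funext => p /=; exact: vconsK.
rewrite preimage_id product_measure1E// lte_mul_pinfty// ge0_fin_numE//.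
Qed.

HB.instance Definition _ := Measure_isSigmaFinite.Build _ _ _ mconsR
  mconsR_sigma_finite.

Lemma integral_mconsR (f : d.+1.-tuple R -> \bar R) :
  measurable_fun setT f -> (forall x, 0 <= f x)%E ->
  (\int[mconsR]_x f x =
   \int[@lebesgue_measure R]_x \int[mu]_t f [tuple of x :: t])%E.
Proof.
move=> mf f0; rewrite ge0_integral_pushforward //; last exact: measurable_vcons.
rewrite preimage_setT fubini_tonelli1 //.
  exact: (measurableT_comp mf (@measurable_vcons d)).
by move=> x; exact: f0.
Qed.

End product_with_line.

(** Dimension 0 carries the Dirac mass at the empty tuple, and each further coordinate is a product
    with the line pushed forward along [vcons]. Sigma-finiteness is part of the induction because
    Tonelli needs it at the next step. *)
Lemma exists_tuple_lebesgue d :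
  exists mu : {sigma_finite_measure set (d.-tuple R) -> \bar R},
  forall f, measurable_fun setT f -> (forall x, 0 <= f x)%E ->
    (\int[mu]_x f x = iint f)%E.
Proof.
elim: d => [|d [mu IH]].
  exists (\d_[tuple])=> f mf f0.
  by rewrite integral_dirac//= diracT mul1e.
exists (mconsR mu) => f mf f0; rewrite integral_mconsR //=.
by apply: eq_integral => x _; rewrite IH //; exact: measurable_slice.
Qed.

(** [iint] is only a functional on functions; a measure with the same integrals gives access to
    monotone convergence, additivity and Tonelli. *)
Definition leb d : {sigma_finite_measure set (d.-tuple R) -> \bar R} :=
  sval (cid (exists_tuple_lebesgue d)).

Lemma iintE d (f : d.-tuple R -> \bar R) :
  measurable_fun setT f -> (forall x, 0 <= f x)%E ->
  iint f = (\int[leb d]_x f x)%E.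
Proof. by move=> mf f0; rewrite (svalP (cid (exists_tuple_lebesgue d))). Qed.

Lemma integral_leb0 (f : 0.-tuple R -> \bar R) :
  measurable_fun setT f -> (forall x, 0 <= f x)%E ->
  (\int[leb 0]_x f x = f [tuple])%E.
Proof. by move=> mf f0; rewrite -iintE. Qed.

Lemma measurable_slice_integral d (f : d.+1.-tuple R -> \bar R) :
  measurable_fun setT f -> (forall x, 0 <= f x)%E ->
  measurable_fun setT (fun x => \int[leb d]_t f [tuple of x :: t])%E.
Proof.
move=> mf f0.
apply: (measurable_fun_fubini_tonelli_F (fun p => f (vcons p))) => //.
exact: (measurableT_comp mf (@measurable_vcons d)).
Qed.

Lemma integral_lebS d (f : d.+1.-tuple R -> \bar R) :
  measurable_fun setT f -> (forall x, 0 <= f x)%E ->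
  (\int[leb d.+1]_x f x =
   \int[@lebesgue_measure R]_x \int[leb d]_t f [tuple of x :: t])%E.
Proof.
move=> mf f0; rewrite -iintE //=.
by apply: eq_integral => x _; rewrite iintE //; exact: measurable_slice.
Qed.

Lemma volE d (A : set (d.-tuple R)) : measurable A -> vol A = leb d A.
Proof.
move=> mA; rewrite /vol iintE.
- by rewrite integral_indic // setIT.
- exact/measurable_EFinP/measurable_indic.
- by move=> x; rewrite lee_fin.
Qed.

End tuple_measure.
Arguments leb {R} d.

(** * Affine changes of variables *)

Section affine.
Context {R : realType}.
Notation mu := (@lebesgue_measure R).

Lemma preimage_affine_itv (a b u v : R) : a != 0 ->
  mu ((fun x => a * x + b) @^-1` `]u, v]%classic) = (`|a|^-1 *  Num.max 0 (v - u))%:E.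
Proof.
move=> a0; case: (ltgtP a 0) a0 => // [aN|aP] _.
- rewrite (_ : _ @^-1` _ = `[(v - b) / a, (u - b) / a[%classic).
    rewrite lebesgue_measure_itv/= lte_fin ltr_ndivlMr // divfK ?lt_eqF //.
    rewrite ltrD2r ltr0_norm //; have [uv|uv] := ltP u v.
      rewrite max_r ?subr_ge0 ?ltW // -EFinB; congr EFin.
      by field; rewrite lt_eqF.
    by rewrite max_l ?mulr0 // subr_le0.
  apply/seteqP; split=> x /=; rewrite !in_itv/=.
    by move=> /andP[ux xv]; rewrite ler_ndivrMr // ltr_ndivlMr // mulrC; lra.
  by move=> /andP[]; rewrite ler_ndivrMr // ltr_ndivlMr // mulrC; lra.
- rewrite (_ : _ @^-1` _ = `](u - b) / a, (v - b) / a]%classic).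
    rewrite lebesgue_measure_itv/= lte_fin ltr_pdivrMr // divfK ?gt_eqF //.
    rewrite ltrD2r gtr0_norm //; have [uv|uv] := ltP u v.
      rewrite max_r ?subr_ge0 ?ltW // -EFinB; congr EFin.
      by field; rewrite gt_eqF.
    by rewrite max_l ?mulr0 // subr_le0.
  apply/seteqP; split=> x /=; rewrite !in_itv/=.
    by move=> /andP[ux xv]; rewrite ltr_pdivrMr // ler_pdivlMr // mulrC; lra.
  by move=> /andP[]; rewrite ltr_pdivrMr // ler_pdivlMr // mulrC; lra.
Qed.

Lemma measurable_affine (a b : R) :
  measurable_fun setT (fun x : measurableTypeR R => a * x + b : measurableTypeR R).
Proof. by apply: measurable_funD => //; exact: measurable_funM. Qed.

(** By uniqueness, Lebesgue measure is [|a|] times its pushforward along the affine map: the two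
    agree on half-open intervals. *)
Lemma integral_affine (a b : R) (f : R -> \bar R) : a != 0 ->
  measurable_fun [set: R] f -> (forall x, 0 <= f x)%E ->
  (\int[mu]_x f (a * x + b)%R = (`|a|^-1)%:E * \int[mu]_x f x)%E.
Proof.
move=> a0 mf f0.
pose g (x : measurableTypeR R) : measurableTypeR R := a * x + b.
have mg : measurable_fun setT g by exact: measurable_affine.
have an : 0 <= `|a| by [].
rewrite [X in (_ = _ * X)%E](@eq_measure_integral _ _ _ _
    (mscale (NngNum an) (pushforward mu g))) //; last first.
  move=> A mA _; apply: lebesgue_measure_unique => //= _ [[u v]] _ <-.
  rewrite /mscale/= /pushforward preimage_affine_itv // lebesgue_measure_itv/=.
  rewrite -EFinM mulrA divff ?normr_eq0 // mul1r lte_fin.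
  have [uv|uv] := ltP u v; first by rewrite max_r ?subr_ge0 ?ltW.
  by rewrite max_l ?subr_le0.
rewrite ge0_integral_mscale //= ge0_integral_pushforward //.
by rewrite preimage_setT muleA -EFinM mulVf ?normr_eq0 // mul1e.
Qed.

Lemma measurable_tuple_fun d d' (T : measurableType d') (f : T -> d.-tuple R) :
  (forall i, measurable_fun setT (fun x => tnth (f x) i)) -> measurable_fun setT f.
Proof. by move=> mf; apply/measurable_fun_tnthP. Qed.

Lemma measurable_vadd_vscale d (a : R) (c : d.-tuple R) :
  measurable_fun setT (fun x => vadd c (vscale a x)).
Proof.
apply: measurable_tuple_fun => i.
rewrite (_ : (fun _ => _) = fun x => tnth c i + a * tnth x i); last first.
  by apply/funext => x; rewrite !tnth_mktuple.
by apply: measurable_funD => //; apply: measurable_funM => //; exact: measurable_tnth.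
Qed.

Lemma tuple_eq d (x y : d.-tuple R) : (forall i, tnth x i = tnth y i) -> x = y.
Proof. by move=> xy; apply/eq_from_tnth. Qed.

Lemma vadd_cons d (a b : R) (x y : d.-tuple R) :
  vadd [tuple of a :: x] [tuple of b :: y] = [tuple of a + b :: vadd x y].
Proof.
apply: tuple_eq => i; rewrite tnth_mktuple.
by case: (unliftP ord0 i) => [j ->|->]; rewrite ?tnthS ?tnth_mktuple// !tnth0.
Qed.

Lemma vsub_cons d (a b : R) (x y : d.-tuple R) :
  vsub [tuple of a :: x] [tuple of b :: y] = [tuple of a - b :: vsub x y].
Proof.
apply: tuple_eq => i; rewrite tnth_mktuple.
by case: (unliftP ord0 i) => [j ->|->]; rewrite ?tnthS ?tnth_mktuple// !tnth0.
Qed.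

Lemma vscale_cons d (a b : R) (x : d.-tuple R) :
  vscale a [tuple of b :: x] = [tuple of a * b :: vscale a x].
Proof.
apply: tuple_eq => i; rewrite tnth_mktuple.
by case: (unliftP ord0 i) => [j ->|->]; rewrite ?tnthS ?tnth_mktuple// !tnth0.
Qed.

Lemma integral_leb_affine d (a : R) (c : d.-tuple R) (f : d.-tuple R -> \bar R) :
  a != 0 -> measurable_fun setT f -> (forall x, 0 <= f x)%E ->
  (\int[leb d]_x f (vadd c (vscale a x)) =
   (`|a|^-1 ^+ d)%:E * \int[leb d]_x f x)%E.
Proof.
move=> a0; elim: d c f => [|d IH] c f mf f0.
  rewrite !integral_leb0 // ?expr0 ?mul1e; last first.
    exact: (measurableT_comp mf (measurable_vadd_vscale _ _)).
  by rewrite [X in f X]tuple0.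
rewrite !integral_lebS // ; last first.
  exact: (measurableT_comp mf (measurable_vadd_vscale _ _)).
case/tupleP: c => c0 c.
pose F x := (\int[leb d]_t f [tuple of x :: t])%E.
transitivity (\int[mu]_x ((`|a|^-1 ^+ d)%:E * F (a * x + c0)%R))%E.
  apply: eq_integral => x _.
  rewrite -(IH c (fun t => f [tuple of _ :: t])) //; last exact: measurable_slice.
  by apply: eq_integral => t _; rewrite vscale_cons vadd_cons addrC.
have mF : measurable_fun setT F by exact: measurable_slice_integral.
have F0 x : (0 <= F x)%E by exact: integral_ge0.
have mFa : measurable_fun setT (fun x : R => F (a * x + c0)).
  exact: (measurableT_comp mF (measurable_affine a c0)).
have c_ge0 : 0 <= `|a|^-1 ^+ d by rewrite exprn_ge0.
rewrite (ge0_integralZl_EFin mu measurableT (fun x _ => F0 (a * x + c0)) mFa c_ge0).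
by rewrite (integral_affine c0 a0 mF F0) muleA -EFinM exprSr.
Qed.

Lemma leb_affine d (a : R) (c : d.-tuple R) (A : set (d.-tuple R)) :
  a != 0 -> measurable A ->
  leb d ((fun x => vadd c (vscale a x)) @^-1` A) = ((`|a|^-1 ^+ d)%:E * leb d A)%E.
Proof.
move=> a0 mA.
have mg : measurable_fun setT (fun x => vadd c (vscale a x)).
  exact: measurable_vadd_vscale.
have mgA : measurable ((fun x => vadd c (vscale a x)) @^-1` A).
  by rewrite -[X in measurable X]setTI; exact: mg.
transitivity (\int[leb d]_x (\1_A (vadd c (vscale a x)))%:E)%E.
  by rewrite (integral_indic _ measurableT mgA) setIT.
rewrite (integral_leb_affine c (f := fun x => (\1_A x)%:E)) //.
- by rewrite integral_indic // setIT.
- exact/measurable_EFinP/measurable_indic.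
Qed.

End affine.

Lemma integral_indicT d (T : measurableType d) (R : realType)
    (m : {measure set T -> \bar R}) (A : set T) :
  measurable A -> (\int[m]_x (\1_A x)%:E)%E = m A.
Proof. by move=> mA; rewrite integral_indic // setIT. Qed.

Lemma le_measureS d (T : measurableType d) (R : realType)
    (m : {measure set T -> \bar R}) (A B : set T) :
  measurable A -> measurable B -> A `<=` B -> (m A <= m B)%E.
Proof. by move=> mA mB AB; apply: le_measure; rewrite ?inE. Qed.

(** * Layer-cake formula between two graphs *)

Section region.
Context {R : realType} d (T : measurableType d).
Variable m : {sigma_finite_measure set T -> \bar R}.
Notation mu := (@lebesgue_measure R).
Variables l u : T -> R.
Hypotheses (ml : measurable_fun setT l) (mu_ : measurable_fun setT u).

Lemma measurable_region :
  measurable [set p : T * measurableTypeR R | l p.1 < p.2 < u p.1].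
Proof.
have mfst (h : T -> R) : measurable_fun setT h ->
    measurable_fun setT (fun p : T * measurableTypeR R => h p.1).
  by move=> mh; exact: (measurableT_comp mh).
have -> : [set p : T * measurableTypeR R | l p.1 < p.2 < u p.1] =
  (fun p : T * measurableTypeR R => (l p.1 < p.2) && (p.2 < u p.1)) @^-1` [set true].
  by apply/seteqP; split => p.
rewrite -[X in measurable X]setTI.
have : measurable_fun setT
    (fun p : T * measurableTypeR R => (l p.1 < p.2) && (p.2 < u p.1)).
  by apply: measurable_and; apply: measurable_fun_ltr => //; exact: mfst.
by apply.
Qed.

Lemma measurable_level (t : R) : measurable [set x | l x < t < u x].
Proof.
rewrite -[X in measurable X]setTI.
have -> : [set x | l x < t < u x] =
  (fun x => (l x < t) && (t < u x)) @^-1` [set true].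
  by apply/seteqP; split => p.
have : measurable_fun setT (fun x => (l x < t) && (t < u x)).
  by apply: measurable_and; exact: measurable_fun_ltr.
by apply.
Qed.

Lemma measurable_fun_level :
  measurable_fun setT (fun t : measurableTypeR R => m [set x | l x < t < u x]).
Proof.
have := indic_measurable_fun_fubini_tonelli_G m measurable_region.
congr measurable_fun; apply/funext => t; rewrite /fubini_G.
by rewrite -[RHS]integral_indicT; last exact: measurable_level.
Qed.

(** Tonelli for the region between the graphs of [l] and [u]. Both bounds are free because the
    reflected levels [1 - phi x < a < 2^-1] occur later beside the usual ones [0 < a < phi x]. *)
Lemma region_tonelli :
  (\int[m]_x (Num.max 0 (u x - l x))%R%:E =
   \int[mu]_t m [set x | (l x < t < u x)%R])%E.
Proof.
have := indic_fubini_tonelli m mu measurable_region.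
rewrite /fubini_F /fubini_G => h.
transitivity (\int[m]_x \int[mu]_y (\1_[set p : T * measurableTypeR R | (l p.1 < p.2 < u p.1)%R] (x, y))%:E)%E.
  apply: eq_integral => x _.
  transitivity (mu `]l x, u x[%classic).
    rewrite lebesgue_measure_itv /= lte_fin; have [lu|ul] := ltP (l x) (u x).
      by rewrite max_r ?subr_ge0 ?ltW.
    by rewrite max_l ?subr_le0.
  by rewrite -[LHS]integral_indicT.
rewrite {}h; apply: eq_integral => t _.
by rewrite -[RHS]integral_indicT; last exact: measurable_level.
Qed.

End region.

(** * Brunn-Minkowski on the line, for half-differences *)

Section brunn_minkowski_line.
Context {R : realType}.
Notation mu := (@lebesgue_measure R).

(** Truncations at points of [A] exhaust [A], except possibly for the single point [sup A], which is
    null; continuity from below does the rest. *)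
Lemma measure_le_truncations (A : set R) (c : \bar R) : measurable A -> A !=set0 ->
  (forall a, A a -> (mu (A `&` `]-oo, a[) <= c)%E) -> (mu A <= c)%E.
Proof.
move=> mA A0 Ac.
suff [x [Z [nx xA mZ Z0 AZ]]] : exists (x : nat -> R) (Z : set R),
    [/\ {homo x : i j / (i <= j)%N >-> i <= j}, (forall n, exists2 a, A a & x n < a),
      measurable Z, mu Z = 0%E & A `<=` Z `|` \bigcup_n `]-oo, x n[%classic].
  have mAx n : measurable (A `&` `]-oo, x n[%classic) by exact: measurableI.
  have mU : measurable (\bigcup_n (A `&` `]-oo, x n[%classic)) by exact: bigcup_measurable.
  have -> : mu A = mu (\bigcup_n (A `&` `]-oo, x n[%classic)).
    apply/eqP; rewrite eq_le; apply/andP; split; last first.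
      by apply: le_measureS => // y [n _ []].
    rewrite -[leRHS]add0e -Z0; apply: le_trans (measureU2 _ _ _) => //.
    apply: le_measureS => //; first exact: measurableU.
    by move=> y Ay; have [Zy|[n _ yn]] := AZ _ Ay; [left|right; exists n].
  have := @nondecreasing_cvg_mu _ _ _ mu (fun n => A `&` `]-oo, x n[%classic) mAx mU.
  move=> /(_ _)/cvge_to_le; apply.
    move=> i j ij; apply/subsetPset => y [Ay /=]; rewrite ?in_itv/= => yi.
    by split => //=; rewrite ?in_itv/= (lt_le_trans yi) // nx.
  apply: nearW => n /=; have [a Aa xa] := xA n.
  apply: le_trans (Ac a Aa); apply: le_measureS; [exact: measurableI..|].
  by move=> y [Ay /=]; rewrite ?in_itv/= => yn; split => //=; rewrite ?in_itv/= (lt_trans yn).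
have [uA|nuA] := pselect (has_ubound A).
  exists (fun n => sup A - n.+1%:R^-1), [set sup A]; split.
  - move=> i j ij; rewrite lerB // lef_pV2 ?posrE ?ltr0n // ler_nat ltnS //.
  - move=> n; have /(sup_adherent (E := A)) : 0 < n.+1%:R^-1 :> R by rewrite invr_gt0.
    by case=> [|a Aa xa]; [split|exists a].
  - exact: measurable_set1.
  - exact: lebesgue_measure_set1.
  - move=> y Ay; have : y <= sup A by apply: ub_le_sup.
    rewrite le_eqVlt => /orP[/eqP ->|yA]; [by left|right].
    have [n yn] : exists n : nat, n.+1%:R^-1 < sup A - y.
      have y0 : 0 < sup A - y by rewrite subr_gt0.
      by case: (near_infty_natSinv_lt (PosNum y0)) => n _ /(_ n (leqnn n)); exists n.
    by exists n => //=; rewrite ?in_itv/= ltrBrDr addrC -ltrBrDr.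
exists (fun n => n%:R), set0; split => //.
- by move=> i j ij; rewrite ler_nat.
- move=> n; apply: contrapT => h; apply: nuA; exists n%:R => a Aa.
  by rewrite leNgt; apply/negP => na; apply: h; exists a.
- move=> y Ay; right; exists (Num.truncn `|y|).+1 => //=; rewrite ?in_itv/=.
  by apply: le_lt_trans (ler_norm y) _; exact: truncnS_gt.
Qed.

(** Fix [a] in [A] and [b] in [B]. The points [(x - b) / 2] with [x] in [A] below [a] lie to the
    left of [(a - b) / 2], the points [(a - y) / 2] with [y] in [B] below [b] lie to its right, and
    both families are in [H]. Differences replace the usual sums because the later hypotheses bound
    [N (vsub x y)]. *)
Lemma measure_half_diff (A B H : set R) :
  measurable A -> measurable B -> measurable H -> A !=set0 -> B !=set0 ->
  (forall x y, A x -> B y -> H ((x - y) / 2)) ->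
  (mu A + mu B <= 2%:E * mu H)%E.
Proof.
move=> mA mB mH A0 B0 ABH.
have key a b : A a -> B b ->
    (mu (A `&` `]-oo, a[%classic) + mu (B `&` `]-oo, b[%classic) <= 2%:E * mu H)%E.
  move=> Aa Bb.
  have mA' : measurable (A `&` `]-oo, a[%classic) by exact: measurableI.
  have mB' : measurable (B `&` `]-oo, b[%classic) by exact: measurableI.
  have aff (p q : R) (E : set R) : `|p| = 2 -> measurable E ->
      (mu E = 2%:E * mu ((fun x => (p * x + q)%R) @^-1` E))%E /\
      measurable ((fun x => (p * x + q)%R) @^-1` E).
    move=> p2 mE.
    have p0 : p != 0 by rewrite -normr_eq0 p2.
    have mpE : measurable ((fun x : R => (p * x + q)%R) @^-1` E).
      by rewrite -[X in measurable X]setTI; exact: measurable_affine.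
    split => //.
    transitivity (2%:E * \int[mu]_x (\1_E (p * x + q)%R)%:E)%E.
      rewrite (integral_affine q (f := fun x => (\1_E x)%:E)) //.
        by rewrite integral_indicT // p2 muleA -EFinM divff ?mul1e.
      exact/measurable_EFinP/measurable_indic.
    by congr (_ * _)%E; exact: integral_indicT.
  have n2 : `|2| = 2 :> R by rewrite ger0_norm.
  have nN2 : `|- 2| = 2 :> R by rewrite normrN.
  have [EA mA2] := aff 2 b _ n2 mA'.
  have [EB mB2] := aff (-2) a _ nN2 mB'.
  rewrite EA EB.
  rewrite -ge0_muleDr ?measure_ge0 // lee_pmul2l // -measureU //.
  - apply: le_measureS => //; first exact: measurableU.
    move=> z [[/= Az _]|[/= Bz _]].
      by have := ABH _ _ Az Bb; congr H; field.
    by have := ABH _ _ Aa Bz; congr H; field.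
  - apply/seteqP; split => z //= [[_]]; rewrite ?in_itv/= => za [_].
    by rewrite ?in_itv/= => zb; exfalso; lra.
have [->|Hoo] := eqVneq (mu H) +oo%E; first by rewrite gt0_muley ?leey // lte_fin.
have Hfin : mu H \is a fin_num by rewrite ge0_fin_numE // lt_neqAle Hoo leey.
have fin2 : (2%:E * mu H)%E \is a fin_num by rewrite fin_numM.
have key2 b : B b -> (mu A + mu (B `&` `]-oo, b[%classic) <= 2%:E * mu H)%E.
  move=> Bb.
  have bfin : mu (B `&` `]-oo, b[%classic) \is a fin_num.
    have [a Aa] := A0; rewrite ge0_fin_numE // (@le_lt_trans _ _ (2%:E * mu H)%E) //.
      by apply: le_trans (key a b Aa Bb); rewrite leeDr.
    by rewrite ltey_eq fin2.
  rewrite -leeBrDr //; apply: measure_le_truncations => // a Aa.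
  by rewrite leeBrDr //; exact: key.
have afin : mu A \is a fin_num.
  have [b Bb] := B0; rewrite ge0_fin_numE // (@le_lt_trans _ _ (2%:E * mu H)%E) //.
    by apply: le_trans (key2 b Bb); rewrite leeDl.
  by rewrite ltey_eq fin2.
rewrite addeC -leeBrDr //; apply: measure_le_truncations => // b Bb.
by rewrite leeBrDr // addeC; exact: key2.
Qed.

End brunn_minkowski_line.

(** * The Prekopa-Leindler inequality *)

Section prekopa_leindler.
Context {R : realType}.
Notation mu := (@lebesgue_measure R).

(** The line inequality needs both level sets to be nonempty at the same heights; with both suprema
    equal to 1 this holds for every [t < 1], and the inequality is integrated over [t]. *)
Lemma prekopa_leindler_normalized (f g h : R -> R) :
  measurable_fun setT f -> measurable_fun setT g -> measurable_fun setT h ->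
  (forall x, 0 <= f x <= 1) -> (forall x, 0 <= g x <= 1) -> (forall x, 0 <= h x) ->
  (forall t, t < 1 -> exists x, t < f x) -> (forall t, t < 1 -> exists x, t < g x) ->
  (forall t x y, 0 < t -> t < f x -> t < g y -> t < h ((x - y) / 2)) ->
  (\int[mu]_x (f x)%:E + \int[mu]_x (g x)%:E <= 2%:E * \int[mu]_x (h x)%:E)%E.
Proof.
move=> mf mg mh f01 g01 h0 f1 g1 fgh.
have cake (k : R -> R) : measurable_fun setT k -> (forall x, 0 <= k x) ->
    (\int[mu]_x (k x)%:E = \int[mu]_t mu [set x | (0 < t < k x)%R])%E.
  move=> mk k0; rewrite -(region_tonelli mu (l := fun=> 0)) //.
  by apply: eq_integral => x _; rewrite subr0 max_r.
have f0 x : 0 <= f x by case/andP: (f01 x).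
have g0 x : 0 <= g x by case/andP: (g01 x).
have mlev (k : R -> R) : measurable_fun setT k ->
   measurable_fun setT (fun t : R => mu [set x | (0 < t < k x)%R]).
  move=> mk; exact: (measurable_fun_level mu (l := fun=> 0)).
have mset (k : R -> R) (t : R) : measurable_fun setT k -> measurable [set x | (0 < t < k x)%R].
  move=> mk; exact: (measurable_level (l := fun=> 0)).
rewrite !cake // -ge0_integralZl //; last exact: mlev.
rewrite -ge0_integralD //; [|exact: mlev..].
apply: ge0_le_integral => //.
- by move=> t _; rewrite adde_ge0.
- by apply: emeasurable_funD; exact: mlev.
- by apply: measurable_funeM; exact: mlev.
move=> t _; have [t0|t0] := ltP 0 t; last first.
  have E0 k : [set x : R | (0 < t < k x)%R] = set0.
    by apply/seteqP; split => x //=; rewrite ltNge t0.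
  have E1 k : [set x : R | (false && (t < k x))%R] = set0.
    by apply/seteqP; split.
  by rewrite !E1 measure0 adde0 mule0.
have [t1|t1] := ltP t 1; last first.
  have E0 k : (forall x, k x <= 1) -> [set x : R | (true && (t < k x))%R] = set0.
    by move=> k1; apply/seteqP; split => x //=; rewrite ltNge (le_trans (k1 x)).
  rewrite (E0 f) ?(E0 g) ?measure0 ?adde0 ?mule_ge0 //.
  - by move=> x; case/andP: (g01 x).
  - by move=> x; case/andP: (f01 x).
apply: measure_half_diff.
- by have := mset f t mf; rewrite t0.
- by have := mset g t mg; rewrite t0.
- by have := mset h t mh; rewrite t0.
- by have [x fx] := f1 t t1; exists x.
- by have [x gx] := g1 t t1; exists x.
- by move=> x y /= fx gy; exact: fgh.
Qed.

(** Divide [f] and [g] by their suprema and [h] by the geometric mean [c] of these; the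
    arithmetic-geometric mean inequality turns the additive bound into a product. [h] has extended
    values because in higher dimension it is a slice integral, possibly infinite. *)
Lemma prekopa_leindler_bounded (f g : R -> R) (h : R -> \bar R) :
  measurable_fun setT f -> measurable_fun setT g -> measurable_fun setT h ->
  (forall x, 0 <= f x) -> (forall x, 0 <= g x) -> (forall x, 0 <= h x)%E ->
  (exists M, forall x, f x <= M) -> (exists M, forall x, g x <= M) ->
  (forall x y, (f x * g y)%:E <= h ((x - y) / 2)%R * h ((x - y) / 2)%R)%E ->
  (\int[mu]_x (f x)%:E * \int[mu]_x (g x)%:E <= (\int[mu]_x h x) * \int[mu]_x h x)%E.
Proof.
move=> mf mg mh f0 g0 h0 [M fM] [M' gM] fgh.
have Ih0 : (0 <= \int[mu]_x h x)%E by exact: integral_ge0.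
have zero (k : R -> R) : (forall x, 0 <= k x) -> ~ (exists x, 0 < k x) ->
    (\int[mu]_x (k x)%:E = 0)%E.
  move=> k0 nk; apply: integral0_eq => x _; apply/eqP; rewrite eqe.
  by rewrite eq_le k0 andbT leNgt; apply/negP => kx; apply: nk; exists x.
have [[xf fpos]|nf] := pselect (exists x, 0 < f x); last first.
  by rewrite (zero f) // mul0e mule_ge0.
have [[xg gpos]|ng] := pselect (exists x, 0 < g x); last first.
  by rewrite (zero g) // mule0 mule_ge0.
have supP (k : R -> R) (K : R) x0 : (forall x, k x <= K) -> 0 < k x0 ->
    exists p, [/\ 0 < p, forall x, k x <= p & forall t, t < p -> exists x, t < k x].
  move=> kK kx0.
  have hs : has_sup (range k) by split; [exists (k x0), x0|exists K => _ [x _ <-]].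
  have kp x : k x <= sup (range k).
    by apply: sup_upper_bound => //; exists x.
  exists (sup (range k)); split => //; first exact: lt_le_trans (kp x0).
  move=> t tp; have /sup_adherent/(_ hs) : 0 < sup (range k) - t by rewrite subr_gt0.
  by case=> _ [x _ <-] tx; exists x; rewrite subKr in tx.
have [p [p0 fp pf]] := supP f M xf fM fpos.
have [q [q0 gq qg]] := supP g M' xg gM gpos.
pose c := Num.sqrt (p * q).
have pq0 : 0 < p * q by exact: mulr_gt0.
have c0 : 0 < c by rewrite sqrtr_gt0.
have c2 : c * c = p * q by rewrite -expr2 sqr_sqrtr // ltW.
(* Cutting [h] at [c] makes it real-valued and loses nothing, since only levels [t < 1] of [h / c]
   are tested. *)
pose h' x : R := fine (mine (h x) c%:E).
have minfin x : mine (h x) c%:E \is a fin_num.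
  rewrite ge0_fin_numE; last by rewrite le_min h0 lee_fin ltW.
  by rewrite gt_min ltry orbT.
have h'E x : (h' x)%:E = mine (h x) c%:E by rewrite /h' fineK.
have mh' : measurable_fun setT h'.
  have : measurable_fun setT (EFin \o h').
    rewrite (_ : _ \o _ = fun x => mine (h x) c%:E); last by apply/funext => x /=.
    exact: measurable_mine.
  by move/measurable_EFinP.
have h'0 x : 0 <= h' x by rewrite -lee_fin h'E le_min h0 lee_fin ltW.
have hh' : (\int[mu]_x (h' x)%:E <= \int[mu]_x h x)%E.
  apply: ge0_le_integral => //.
  - by move=> x _; rewrite lee_fin.
  - exact/measurable_EFinP.
  - by move=> x _; rewrite h'E ge_min lexx.
have := @prekopa_leindler_normalized (fun x => p^-1 * f x) (fun x => q^-1 * g x)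
  (fun x => c^-1 * h' x).
have pi0 : 0 <= p^-1 by rewrite invr_ge0 ltW.
have qi0 : 0 <= q^-1 by rewrite invr_ge0 ltW.
have ci0 : 0 <= c^-1 by rewrite invr_ge0 ltW.
have fp1 x : 0 <= p^-1 * f x <= 1.
  by rewrite mulr_ge0 //= mulrC ler_pdivrMr // mul1r.
have gq1 x : 0 <= q^-1 * g x <= 1.
  by rewrite mulr_ge0 //= mulrC ler_pdivrMr // mul1r.
move=> /(_ _ _ _ fp1 gq1) h1.
have {}h1 : ((p^-1)%:E * \int[mu]_x (f x)%:E + (q^-1)%:E * \int[mu]_x (g x)%:E <=
   2%:E * ((c^-1)%:E * \int[mu]_x (h' x)%:E))%E.
  have Zl (k : R -> R) r : measurable_fun setT k -> (forall x, 0 <= k x) -> 0 <= r ->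
      (r%:E * \int[mu]_x (k x)%:E = \int[mu]_x (r * k x)%:E)%E.
    move=> mk k0 r0; rewrite -ge0_integralZl_EFin //; last exact/measurable_EFinP.
    by move=> x _; rewrite lee_fin.
  rewrite (Zl f) // (Zl g) // (Zl h') //; apply: h1; try exact: measurable_funM.
  - by move=> x; rewrite mulr_ge0.
  - move=> t t1; have [|x tx] := pf (t * p); first by rewrite gtr_pMl.
    by exists x; rewrite mulrC ltr_pdivlMr.
  - move=> t t1; have [|x tx] := qg (t * q); first by rewrite gtr_pMl.
    by exists x; rewrite mulrC ltr_pdivlMr.
  - move=> t x y t0 tf tg.
    have t1 : t < 1 by apply: (lt_le_trans tf); case/andP: (fp1 x).
    have {}tf : t * p < f x by rewrite -ltr_pdivlMr // mulrC.
    have {}tg : t * q < g y by rewrite -ltr_pdivlMr // mulrC.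
    rewrite mulrC ltr_pdivlMr // -lte_fin h'E lt_min lte_fin gtr_pMl // t1 andbT.
    rewrite ltNge; apply/negP => htc.
    have : (h ((x - y) / 2)%R * h ((x - y) / 2)%R <= (t * c * (t * c))%:E)%E.
      by rewrite EFinM; apply: lee_pmul.
    apply/negP; rewrite -ltNge; apply: lt_le_trans (fgh x y); rewrite lte_fin.
    rewrite mulrACA c2 mulrACA; apply: ltr_pM => //; rewrite mulr_ge0 // ltW //.
have [Ioo|Ioo] := eqVneq (\int[mu]_x h x)%E +oo%E; first by rewrite Ioo mulyy leey.
have Ifin : (\int[mu]_x h x \is a fin_num)%E by rewrite ge0_fin_numE // lt_neqAle Ioo leey.
have {}h1 : ((p^-1)%:E * \int[mu]_x (f x)%:E + (q^-1)%:E * \int[mu]_x (g x)%:E <=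
   2%:E * ((c^-1)%:E * \int[mu]_x h x))%E.
  by apply: (le_trans h1); rewrite !lee_pmul2l // lte_fin invr_gt0.
have If0 : (0 <= \int[mu]_x (f x)%:E)%E by apply: integral_ge0 => x _; rewrite lee_fin.
have Ig0 : (0 <= \int[mu]_x (g x)%:E)%E by apply: integral_ge0 => x _; rewrite lee_fin.
move: h1 Ih0 If0 Ig0; move: Ifin.
move: (\int[mu]_x h x)%E => [i| |] // _.
move: (\int[mu]_x (f x)%:E)%E (\int[mu]_x (g x)%:E)%E => [a| |] [b| |] //=.
- rewrite -!EFinM -EFinD !lee_fin => h1 i0 a0 b0.
  have h2 : 0 <= p^-1 * a + q^-1 * b by rewrite addr_ge0 // mulr_ge0.
  have h3 : (p^-1 * a + q^-1 * b) ^+ 2 <= (2 * (c^-1 * i)) ^+ 2.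
    by rewrite lerXn2r ?nnegrE // (le_trans h2).
  have h4 : 4 * (p^-1 * a * (q^-1 * b)) <= (p^-1 * a + q^-1 * b) ^+ 2.
    by rewrite -subr_ge0; have := sqr_ge0 (p^-1 * a - q^-1 * b); congr (_ <= _); ring.
  have := le_trans h4 h3.
  have -> : 4 * (p^-1 * a * (q^-1 * b)) = 4 * ((p * q)^-1 * (a * b)) by rewrite invfM; ring.
  have -> : (2 * (c^-1 * i)) ^+ 2 = 4 * ((p * q)^-1 * (i * i)) by rewrite -c2 invfM; ring.
  by rewrite !ler_pM2l // invr_gt0.
- by rewrite gt0_muley ?lte_fin ?invr_gt0 // addey // leye_eq.
- by rewrite gt0_muley ?lte_fin ?invr_gt0 // addye // leye_eq.
- by rewrite !gt0_muley ?lte_fin ?invr_gt0 // addye // leye_eq.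
Qed.

End prekopa_leindler.

Section prekopa_leindler_dim.
Context {R : realType}.
Notation mu := (@lebesgue_measure R).
Local Open Scope ereal_scope.

(** Truncating [f] and [g] at height [n] preserves the pointwise hypothesis; monotone convergence
    then removes the boundedness. *)
Lemma prekopa_leindler_line (f g h : R -> \bar R) :
  measurable_fun setT f -> measurable_fun setT g -> measurable_fun setT h ->
  (forall x, 0 <= f x) -> (forall x, 0 <= g x) -> (forall x, 0 <= h x) ->
  (forall x y, f x * g y <= h ((x - y) / 2)%R * h ((x - y) / 2)%R) ->
  \int[mu]_x f x * \int[mu]_x g x <= (\int[mu]_x h x) * \int[mu]_x h x.
Proof.
move=> mf mg mh f0 g0 h0 fgh.
pose tr (k : R -> \bar R) (n : nat) (x : R) : R := fine (mine (k x) n%:R%:E).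
have trE k n x : 0 <= k x -> (tr k n x)%:E = mine (k x) n%:R%:E.
  move=> kx; rewrite /tr fineK // ge0_fin_numE; last by rewrite le_min kx lee_fin ler0n.
  by rewrite gt_min ltry orbT.
have mtr k n : measurable_fun setT k -> (forall x, 0 <= k x) ->
    measurable_fun setT (tr k n).
  move=> mk k0; apply/measurable_EFinP.
  rewrite (_ : _ \o _ = fun x => mine (k x) n%:R%:E).
    exact: measurable_mine.
  by apply/funext => x /=; rewrite trE.
have tr0 k n x : 0 <= k x -> (0 <= tr k n x)%R.
  by move=> kx; rewrite -lee_fin trE // le_min kx lee_fin ler0n.
have ctr k : measurable_fun setT k -> (forall x, 0 <= k x) ->
    \int[mu]_x (tr k n x)%:E @[n --> \oo] --> \int[mu]_x k x.
  move=> mk k0.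
  have -> : \int[mu]_x k x = \int[mu]_x (limn (fun n => (tr k n x)%:E)).
    apply: eq_integral => x _; apply/esym/cvg_lim => //.
    under eq_fun do rewrite trE //.
    move: (k0 x); case: (k x) => [r r0| |//].
    - apply: cvg_near_cst; exists (Num.truncn r).+1 => // n /= rn.
      by rewrite min_l // lee_fin ltW // (lt_le_trans (truncnS_gt _)) // ler_nat.
    - move=> _; have -> : (fun n : nat => mine +oo n%:R%:E) = (fun n => n%:R%:E : \bar R).
        by apply/funext => n; rewrite min_r ?leey.
      by apply/cvgenyP.
  apply: cvg_monotone_convergence => //.
  - by move=> n; apply/measurable_EFinP; exact: mtr.
  - by move=> n x _; rewrite lee_fin; exact: tr0.
  - move=> x _ m n mn; rewrite !trE // le_min ge_min lexx /= ge_min lee_fin ler_nat mn orbT //.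
have key n : \int[mu]_x (tr f n x)%:E * \int[mu]_x (tr g n x)%:E <=
    (\int[mu]_x h x) * \int[mu]_x h x.
  apply: prekopa_leindler_bounded => //; try exact: mtr; try by move=> x; exact: tr0.
  - by exists n%:R => x; rewrite -lee_fin trE // ge_min lexx orbT.
  - by exists n%:R => x; rewrite -lee_fin trE // ge_min lexx orbT.
  - move=> x y; apply: le_trans (fgh x y); rewrite EFinM !trE //.
    by apply: lee_pmul; rewrite ?ge_min ?lexx // le_min ?f0 ?g0 lee_fin ler0n.
have If0 : 0 <= \int[mu]_x f x by exact: integral_ge0.
have Ig0 : 0 <= \int[mu]_x g x by exact: integral_ge0.
have Ih0 : 0 <= \int[mu]_x h x by exact: integral_ge0.
(* Zero integrals are set aside so that the limit of the product is not of the form [0 * +oo]. *)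
have [->|If] := eqVneq (\int[mu]_x f x) 0; first by rewrite mul0e mule_ge0.
have [->|Ig] := eqVneq (\int[mu]_x g x) 0; first by rewrite mule0 mule_ge0.
have def : \int[mu]_x f x *? \int[mu]_x g x by apply: neq0_mule_def; rewrite mule_neq0.
apply: (cvge_to_le (cvgeM def (ctr f mf f0) (ctr g mg g0))).
by apply: nearW => n; exact: key.
Qed.

(** The slices over [x], [y] and [(x - y) / 2] satisfy the hypothesis in one dimension less; the
    induction hypothesis for them is the pointwise hypothesis on the line for the slice
    integrals. *)
Lemma prekopa_leindler d (f g h : d.-tuple R -> \bar R) :
  measurable_fun setT f -> measurable_fun setT g -> measurable_fun setT h ->
  (forall x, 0 <= f x) -> (forall x, 0 <= g x) -> (forall x, 0 <= h x) ->
  (forall x y, f x * g y <= h (vscale 2^-1 (vsub x y)) * h (vscale 2^-1 (vsub x y))) ->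
  \int[leb d]_x f x * \int[leb d]_x g x <= (\int[leb d]_x h x) * \int[leb d]_x h x.
Proof.
elim: d f g h => [|d IH] f g h mf mg mh f0 g0 h0 fgh.
  by rewrite !integral_leb0 //; have := fgh [tuple] [tuple]; rewrite [X in h X]tuple0.
rewrite !integral_lebS //; apply: prekopa_leindler_line.
- exact: measurable_slice_integral.
- exact: measurable_slice_integral.
- exact: measurable_slice_integral.
- by move=> x; exact: integral_ge0.
- by move=> x; exact: integral_ge0.
- by move=> x; exact: integral_ge0.
move=> x y; apply: IH; [exact: measurable_slice..|by move=> ?|by move=> ?|by move=> ?|].
by move=> s t; have := fgh [tuple of x :: s] [tuple of y :: t];
  rewrite vsub_cons vscale_cons mulrC.
Qed.

End prekopa_leindler_dim.

(** * Cubes, norms and packings *)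

Ltac vring := apply: tuple_eq => ?; rewrite !tnth_mktuple; ring.
Ltac vfield := apply: tuple_eq => ?; rewrite !tnth_mktuple; field.

Section cube.
Context {R : realType}.

Definition cube (d : nat) (a b : R) : set (d.-tuple R) :=
  [set x | forall i, a < tnth x i < b].
Arguments cube d a b : clear implicits.

Lemma measurable_cube d (a b : R) : measurable (cube d a b).
Proof.
have -> : cube d a b = \big[setI/setT]_(i < d) ((@tnth _ R ^~ i) @^-1` `]a, b[%classic).
  apply/seteqP; split => x; rewrite -bigcap_seq.
    by move=> xab i _ /=; rewrite in_itv /=; exact: xab.
  by move=> h i; have := h i; rewrite /= in_itv /=; apply; exact: mem_index_enum.
apply: bigsetI_measurable => i _; rewrite -[X in measurable X]setTI.
exact: measurable_tnth.
Qed.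

Lemma leb_cube d (a b : R) : a <= b -> leb d (cube d a b) = ((b - a) ^+ d)%:E.
Proof.
move=> ab; elim: d => [|d IH].
  rewrite -integral_indicT; last exact: measurable_cube.
  rewrite integral_leb0 //.
    by rewrite expr0 indicE mem_set // => -[].
  apply/measurable_EFinP/measurable_indic; exact: measurable_cube.
rewrite -integral_indicT; last exact: measurable_cube.
rewrite integral_lebS //; last by apply/measurable_EFinP/measurable_indic; exact: measurable_cube.
transitivity (\int[@lebesgue_measure R]_x (((b - a) ^+ d)%:E * (\1_`]a, b[%classic x)%:E))%E.
  apply: eq_integral => x _; rewrite -IH.
  rewrite -[X in _ = (X * _)%E]integral_indicT; last exact: measurable_cube.
  rewrite muleC -ge0_integralZl_EFin //; last by apply/measurable_EFinP/measurable_indic; exact: measurable_cube.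
  apply: eq_integral => t _; rewrite -EFinM; congr EFin.
  rewrite !indicE; case: (boolP (x \in `]a, b[%classic)) => xab; last first.
    rewrite mul0r memNset // => /(_ ord0); rewrite tnth0 => xab'.
    by move/negP: xab; apply; rewrite inE /= in_itv.
  rewrite mul1r; congr (nat_of_bool _)%:R; apply/asbool_equiv_eq; split.
    by move=> h i; have := h (lift ord0 i); rewrite tnthS.
  move=> h i; case: (unliftP ord0 i) => [j ->|->]; rewrite ?tnthS ?tnth0 //.
  by rewrite inE /= in_itv in xab.
rewrite ge0_integralZl_EFin //; last 2 first.
  - exact/measurable_EFinP/measurable_indic.
  - by rewrite exprn_ge0 // subr_ge0.
rewrite integral_indicT //= lebesgue_measure_itv /= lte_fin.
move: ab; rewrite le_eqVlt => /orP[/eqP ->|ab].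
  by rewrite ltxx mule0 subrr expr0n.
by rewrite ab -EFinB -EFinM exprSr.

Qed.

End cube.
Arguments cube {R} d a b.

(** * Measurability of a norm and volumes of its balls *)

Section norm.
Context {R : realType} {d : nat} {N : d.-tuple R -> R} (HN : is_norm N).

Lemma normv_scale (a : R) x : N (vscale a x) = `|a| * N x.
Proof. by case: HN. Qed.

Lemma normv_add x y : N (vadd x y) <= N x + N y.
Proof. by case: HN. Qed.

Lemma normv0 : N (vzero R d) = 0.
Proof.
have -> : vzero R d = vscale 0 (vzero R d) by vring.
by rewrite normv_scale normr0 mul0r.
Qed.

Lemma normv_opp x : N (vscale (-1) x) = N x.
Proof. by rewrite normv_scale normrN1 mul1r. Qed.

Lemma normv_ge0 x : 0 <= N x.
Proof.
have : N (vadd x (vscale (-1) x)) <= N x + N (vscale (-1) x) by exact: normv_add.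
have -> : vadd x (vscale (-1) x) = vzero R d by vring.
by rewrite normv0 normv_opp; lra.
Qed.

Lemma normv_subC x y : N (vsub x y) = N (vsub y x).
Proof. by rewrite -normv_opp; congr N; vring. Qed.

Lemma normv_sub_trans y x z : N (vsub x z) <= N (vsub x y) + N (vsub y z).
Proof. by apply: le_trans (normv_add _ _); rewrite le_eqVlt; apply/orP; left; apply/eqP; congr N; vring. Qed.

(** The coordinates of [x] are switched on one at a time by [tr k x], each costing at most
    [r * N (e i)]. This comparison with the maximum norm gives both the measurability of [N] and the
    positive volume of balls. *)
Lemma normv_le_sup : exists2 c : R, 0 < c & forall (x : d.-tuple R) (r : R), 0 <= r -> (forall i, `|tnth x i| <= r) -> N x <= c * r.
Proof.
pose e (i : 'I_d) : d.-tuple R := [tuple (i == j)%:R | j < d].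
pose tr (k : nat) (x : d.-tuple R) : d.-tuple R := [tuple (j < k)%:R * tnth x j | j < d].
exists (1 + \sum_(i < d) N (e i)).
  by rewrite ltr_pwDl // sumr_ge0 // => i _; exact: normv_ge0.
move=> x r r0 xr.
have key k : (k <= d)%N -> N (tr k x) <= (\sum_(i < d | (i < k)%N) N (e i)) * r.
  elim: k => [|k IH] kd.
    have -> : tr 0 x = vzero R d by apply: tuple_eq => i; rewrite !tnth_mktuple mul0r.
    by rewrite normv0 big_pred0 ?mul0r.
  pose i0 := Ordinal kd.
  have -> : tr k.+1 x = vadd (tr k x) (vscale (tnth x i0) (e i0)).
    apply: tuple_eq => i; rewrite !tnth_mktuple ltnS leq_eqVlt.
    have [<-|ki] := eqVneq i0 i; first by rewrite /= ltnn eqxx /= mul1r mul0r add0r mulr1.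
    rewrite (_ : (nat_of_ord i == k) = false) ?orFb ?mulr0 ?addr0 //.
    by apply/negbTE; apply: contra ki => /eqP ik; apply/eqP/val_inj.
  rewrite (bigD1 i0) //= mulrDl addrC; apply: le_trans (normv_add _ _) _.
  apply: lerD.
    apply: le_trans (IH (ltnW kd)) _; rewrite le_eqVlt; apply/orP; left; apply/eqP.
    congr (_ * _); apply: eq_bigl => i; rewrite ltnS -(inj_eq val_inj) /= ltn_neqAle andbC.
    by [].
  by rewrite normv_scale mulrC ler_wpM2l ?normv_ge0.
have := key d (leqnn d).
have -> : tr d x = x by apply: tuple_eq => i; rewrite tnth_mktuple ltn_ord mul1r.
rewrite (eq_bigl xpredT); last by move=> i; rewrite ltn_ord.
by move=> h; apply: (le_trans h); rewrite mulrDl lerDr mul1r.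
Qed.

(** The sigma-algebra is generated by coordinates, so [{N < r}] is written as a countable union of
    boxes: those with rational centre [q] and half-width [1 / (n + 1)] for which
    [N q + c / (n + 1) < r]. *)
Lemma measurable_normv : measurable_fun setT N.
Proof.
have [c c0 Nc] := normv_le_sup.
apply: (measurability _ (RGenInftyO.measurableE R)) => // _ [_ [r ->] <-].
rewrite setTI.
pose A (qn : d.-tuple rat * nat) : set (d.-tuple R) :=
  if N [tuple ratr (tnth qn.1 i) | i < d] + c * qn.2.+1%:R^-1 < r then
  \big[setI/setT]_(i < d) ((@tnth _ R ^~ i) @^-1`
     `](ratr (tnth qn.1 i) - qn.2.+1%:R^-1), (ratr (tnth qn.1 i) + qn.2.+1%:R^-1)[%classic)
  else set0.
have -> : N @^-1` `]-oo, r[%classic = \bigcup_qn A qn.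
  apply/seteqP; split => x /=.
    rewrite in_itv /= => xr.
    (* Half of the slack pays for moving from [x] to the rational centre, the other half for the
       width of the box. *)
    have c20 : 0 < (r - N x) / (2 * c) by rewrite divr_gt0 ?subr_gt0 // mulr_gt0.
    have [n] : exists n : nat, n.+1%:R^-1 < (r - N x) / (2 * c).
      by case: (near_infty_natSinv_lt (PosNum c20)) => n _ /(_ n (leqnn n)); exists n.
    set e := n.+1%:R^-1 => en.
    have e0 : 0 < e by rewrite invr_gt0 ltr0n.
    have /choice[q xq] : forall i : 'I_d, exists q : rat, `|tnth x i - ratr q| < e.
      move=> i; have [q] := @rat_in_itvoo R (tnth x i - e) (tnth x i + e) ltac:(lra).
      by rewrite in_itv /= => /andP[q1 q2]; exists q; rewrite ltr_norml; lra.
    exists ([tuple q i | i < d], n) => //; rewrite /A /= -/e.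
    have -> : [tuple ratr (tnth [tuple q i0 | i0 < d] i) | i < d] = [tuple ratr (q i) | i < d] :> d.-tuple R.
      by apply: tuple_eq => i; rewrite !tnth_mktuple.
    set y := [tuple ratr (q i) | i < d].
    have Nxy : N (vsub y x) <= c * e.
      apply: Nc; first exact: ltW.
      by move=> i; rewrite !tnth_mktuple distrC ltW.
    have Ny : N y <= N x + c * e.
      apply: le_trans (_ : N (vadd x (vsub y x)) <= _).
        by rewrite le_eqVlt; apply/orP; left; apply/eqP; congr N; vring.
      by apply: le_trans (normv_add _ _) _; rewrite lerD2l.
    have ec : e * (2 * c) < r - N x by rewrite -ltr_pdivlMr // mulr_gt0.
    rewrite ifT; last by lra.
    rewrite -bigcap_seq => i _ /=; rewrite in_itv /= tnth_mktuple.
    by have := xq i; rewrite ltr_norml; lra.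
  move=> [[q n] _]; rewrite /A /=; case: ifP => // Nr.
  rewrite -bigcap_seq => xq; rewrite in_itv /=.
  set y := [tuple ratr (tnth q i) | i < d] in Nr *.
  set e := n.+1%:R^-1 in Nr xq *.
  have e0 : 0 < e by rewrite invr_gt0 ltr0n.
  have Nxy : N (vsub x y) <= c * e.
    apply: Nc => [|i]; first exact: ltW.
    have := xq i; rewrite !tnth_mktuple /= mem_index_enum in_itv /= => /(_ isT) h.
    by rewrite ltW // ltr_norml; lra.
  apply: le_lt_trans Nr; apply: le_trans (_ : N (vadd y (vsub x y)) <= _).
    by rewrite le_eqVlt; apply/orP; left; apply/eqP; congr N; vring.
  by apply: le_trans (normv_add _ _) _; rewrite lerD2l.
apply: countable_bigcupT_measurable; first exact: countableP.
move=> [q n]; rewrite /A; case: ifP => // _.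
apply: bigsetI_measurable => i _; rewrite -[X in measurable X]setTI.
exact: measurable_tnth.
Qed.

Lemma measurable_vsub (x : d.-tuple R) : measurable_fun setT (vsub x).
Proof.
rewrite (_ : vsub x = fun y => vadd x (vscale (-1) y)).
  exact: measurable_vadd_vscale.
by apply/funext => y; vring.
Qed.

Lemma measurable_nball (x : d.-tuple R) (rho : R) : measurable (nball N x rho).
Proof.
have -> : nball N x rho = (N \o vsub x) @^-1` `]-oo, rho[%classic.
  by apply/seteqP; split => y; rewrite /nball /= in_itv.
rewrite -[X in measurable X]setTI.
by apply: (measurableT_comp measurable_normv (measurable_vsub x)).
Qed.

Lemma nball_scale (x : d.-tuple R) (a rho : R) : 0 < a ->
  leb d (nball N x (a * rho)) = ((a ^+ d)%:E * leb d (nball N (vzero R d) rho))%E.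
Proof.
move=> a0.
have -> : nball N x (a * rho) =
  (fun y => vadd (vscale (- a^-1) x) (vscale a^-1 y)) @^-1` nball N (vzero R d) rho.
  apply/seteqP; split => y; rewrite /nball /=;
    have -> : vsub (vzero R d) (vadd (vscale (- a^-1) x) (vscale a^-1 y)) =
              vscale a^-1 (vsub x y) by vring.
    by rewrite normv_scale gtr0_norm ?invr_gt0 // ltr_pdivrMl.
  by rewrite normv_scale gtr0_norm ?invr_gt0 // ltr_pdivrMl.
rewrite leb_affine ?invr_eq0 ?gt_eqF //; last exact: measurable_nball.
by rewrite gtr0_norm ?invr_gt0 // invrK.
Qed.

Lemma leb_nball_gt0 (x : d.-tuple R) (rho : R) : 0 < rho -> (0 < leb d (nball N x rho))%E.
Proof.
move=> rho0; have [c c0 Nc] := normv_le_sup.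
have -> : rho = rho * 1 by rewrite mulr1.
rewrite nball_scale // mule_gt0 // ?lte_fin ?exprn_gt0 //.
set r0 := (2 * c)^-1.
have r00 : 0 < r0 by rewrite invr_gt0 mulr_gt0.
suff : (leb d (cube d (- r0) r0) <= leb d (nball N (vzero R d) 1))%E.
  apply: lt_le_trans; rewrite leb_cube ?lte_fin; last by lra.
  by rewrite exprn_gt0 // opprK addr_gt0.
apply: le_measureS; [exact: measurable_cube|exact: measurable_nball|].
move=> x' xc; rewrite /nball /=.
apply: (@le_lt_trans _ _ (c * r0)).
  apply: Nc; first exact: ltW.
  by move=> i; rewrite !tnth_mktuple sub0r normrN ltW // ltr_norml; exact: xc.
by rewrite /r0 invfM mulrCA divff ?gt_eqF //; lra.
Qed.

End norm.

(** * Averaging over translates of well-spread sets *)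

Section averaging.
Context {R : realType} {d : nat} {N : d.-tuple R -> R} (HN : is_norm N).

Definition spread_in (K : R) (s : seq (d.-tuple R)) :=
  [/\ uniq s, well_spread N [set` s] & forall c, c \in s -> cube d 0 K c].

Definition spread_bounded (psi : d.-tuple R -> R) (m : R) :=
  forall s, uniq s -> well_spread N [set` s] -> \sum_(v <- s) psi v <= m.

Lemma spread_translate (x : d.-tuple R) s : uniq s -> well_spread N [set` s] ->
  uniq [seq vadd x c | c <- s] /\ well_spread N [set` [seq vadd x c | c <- s]].
Proof.
move=> us ws; split.
  rewrite map_inj_uniq // => a b ab; apply: tuple_eq => i.
  by have := congr1 (fun t => tnth t i) ab; rewrite !tnth_mktuple; lra.
move=> _ _ /mapP[a sa ->] /mapP[b sb ->] ab.
have -> : vsub (vadd x a) (vadd x b) = vsub a b by vring.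
by apply: ws => // e; apply: ab; rewrite e.
Qed.

(** Sum the integrals of the translates of the cut-off [psi] by the points of [s]. At each [x] the
    sum is at most [m], because [x + s] is well-spread, and it vanishes unless [x] lies in a cube of
    side [2 * L + K]. *)
Lemma averaging_cube (psi : d.-tuple R -> R) (m K L : R) (s : seq (d.-tuple R)) : measurable_fun setT psi -> (forall x, 0 <= psi x) ->
  spread_bounded psi m -> 0 <= m -> 0 <= K -> 0 <= L -> spread_in K s ->
  ((size s)%:R%:E * \int[leb d]_x (psi x * \1_(cube d (- L) L) x)%:E <=
   (m * (2 * L + K) ^+ d)%:E)%E.
Proof.
move=> mpsi psi0 bpsi m0 K0 L0 [us ws sK].
have mshift (c : d.-tuple R) : measurable_fun setT (fun x => vadd c (vscale 1 x)).
  exact: measurable_vadd_vscale.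
have mind (A : set (d.-tuple R)) : measurable A -> measurable_fun setT (\1_A : _ -> R).
  by move=> mA; exact: measurable_indic.
set g := fun x => psi x * \1_(cube d (- L) L) x.
have mg : measurable_fun setT g.
  by apply: measurable_funM => //; apply: mind; exact: measurable_cube.
have g0 x : 0 <= g x by rewrite mulr_ge0.
have shift (c : d.-tuple R) : (\int[leb d]_x (g x)%:E = \int[leb d]_x (g (vadd c (vscale 1 x)))%:E)%E.
  rewrite (integral_leb_affine c (f := fun x => (g x)%:E)) ?oner_neq0 //.
  - by rewrite normr1 invr1 expr1n mul1e.
  - exact/measurable_EFinP.
set Q := cube d (- (L + K)) L.
have mgc (c : d.-tuple R) : measurable_fun setT (fun x => (g (vadd c (vscale 1 x)))%:E).
  by apply/measurable_EFinP; exact: (measurableT_comp mg (mshift c)).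
have -> : ((size s)%:R%:E * \int[leb d]_x (g x)%:E =
    \int[leb d]_x \sum_(c <- s) (g (vadd c (vscale 1 x)))%:E)%E.
  rewrite ge0_integral_sum //; last by move=> c x _; rewrite lee_fin.
  under eq_bigr do rewrite -shift.
  rewrite big_const_seq count_predT; elim: (size s) => [|n IH] /=.
    by rewrite mul0e.
  rewrite -IH -natr1 EFinD ge0_muleDl ?lee_fin // mul1e addeC //.
rewrite (_ : m * (2 * L + K) ^+ d = m * (L - - (L + K)) ^+ d); last by congr (_ * _ ^+ _); ring.
rewrite EFinM -leb_cube; last by lra.
rewrite -/Q -integral_indicT; last exact: measurable_cube.
rewrite -ge0_integralZl_EFin //; last first.
  by apply/measurable_EFinP; apply: mind; exact: measurable_cube.
apply: ge0_le_integral => //.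
- by move=> x _; apply: sume_ge0 => c _; rewrite lee_fin.
- exact: emeasurable_sum.
- by apply: measurable_funeM; apply/measurable_EFinP; apply: mind; exact: measurable_cube.
move=> x _; rewrite sumEFin -EFinM lee_fin.
rewrite indicE; case: (boolP (x \in Q)) => xQ.
  rewrite mulr1; have [us' ws'] := spread_translate x us ws.
  apply: le_trans (bpsi _ us' ws').
  rewrite big_map; apply: ler_sum => c _.
  have -> : vadd c (vscale 1 x) = vadd x c by vring.
  by rewrite /g ler_piMr // indicE lern1 leq_b1.
rewrite mulr0 big_seq big1 // => c cs; rewrite /g indicE memNset ?mulr0 // => h.
move/negP: xQ; apply; rewrite inE => i; have := h i; have := sK c cs i.
by rewrite !tnth_mktuple; lra.
Qed.

(** A convex function lies below its chord on [[0, 1]]; the induction runs on the exact slope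
    [2 ^ n - 1]. *)
Lemma expr1D_le n (e : R) : 0 <= e <= 1 -> (1 + e) ^+ n <= 1 + 2 ^+ n * e.
Proof.
move=> /andP[e0 e1]; suff : (1 + e) ^+ n <= 1 + (2 ^+ n - 1) * e by lra.
elim: n => [|n IH]; first by rewrite !expr0; lra.
have e1' : 0 <= 1 + e by lra.
rewrite exprSr; apply: le_trans (ler_wpM2r e1' IH) _.
rewrite exprS; have : 1 <= 2 ^+ n :> R by rewrite exprn_ege1 // ler1n.
move: (2 ^+ n) => c c1.
have : 0 <= (c - 1) * e * (1 - e) by rewrite !mulr_ge0 // subr_ge0.
by lra.
Qed.

(** For [K >= 2 * L / e] the boundary costs only a factor [(1 + e) ^ d]. First [e] tends to 0 with
    [L] fixed, then [L] tends to infinity by monotone convergence. *)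
Lemma averaging (psi : d.-tuple R -> R) (m rho : R) : measurable_fun setT psi -> (forall x, 0 <= psi x) ->
  spread_bounded psi m -> 0 <= m -> 0 < rho ->
  (forall K0, exists2 K : R, K0 <= K & exists2 s, spread_in K s & rho * K ^+ d <= (size s)%:R) ->
  (\int[leb d]_x (psi x)%:E <= (m / rho)%:E)%E.
Proof.
move=> mpsi psi0 bpsi m0 rho0 dense.
have mcut L : measurable_fun setT (fun x => psi x * \1_(cube d (- L) L) x).
  by apply: measurable_funM => //; apply: measurable_indic; exact: measurable_cube.
have cut0 L x : 0 <= psi x * \1_(cube d (- L) L) x by rewrite mulr_ge0.
have bound L : 0 < L ->
    (\int[leb d]_x (psi x * \1_(cube d (- L) L) x)%:E <= (m / rho)%:E)%E.
  move=> L0.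
  have key e : 0 < e <= 1 ->
      (\int[leb d]_x (psi x * \1_(cube d (- L) L) x)%:E <= (m / rho * (1 + 2 ^+ d * e))%:E)%E.
    move=> /andP[e0 e1].
    have [K KL [s sK sd]] := dense (2 * L / e).
    have K0 : 0 < K by rewrite (lt_le_trans _ KL) // divr_gt0 // mulr_gt0.
    have s0 : 0 < (size s)%:R :> R by rewrite (lt_le_trans _ sd) // mulr_gt0 // exprn_gt0.
    have := averaging_cube mpsi psi0 bpsi m0 (ltW K0) (ltW L0) sK.
    rewrite -lee_pdivlMl // => /le_trans; apply.
    rewrite -EFinM lee_fin ler_pdivrMl //.
    have LK : 2 * L + K <= K * (1 + e).
      by rewrite mulrDr mulr1 addrC lerD2l -ler_pdivrMr.
    apply: (@le_trans _ _ (m * (K ^+ d * (1 + 2 ^+ d * e)))).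
      apply: ler_wpM2l => //.
      apply: (@le_trans _ _ ((K * (1 + e)) ^+ d)).
        by rewrite lerXn2r ?nnegrE //; nra.
      rewrite exprMn; apply: ler_wpM2l; [exact: exprn_ge0 (ltW K0)|apply: expr1D_le; lra].
    have c0 : 0 <= 1 + 2 ^+ d * e by rewrite addr_ge0 // mulr_ge0 // ?exprn_ge0 // ltW.
    rewrite (_ : (size s)%:R * _ = m * ((size s)%:R / rho * (1 + 2 ^+ d * e))); last by ring.
    by rewrite ler_wpM2l // ler_wpM2r // ler_pdivlMr // mulrC.
  have mr : 0 <= m / rho by rewrite divr_ge0 // ltW.
  apply/lee_addgt0Pr => e e0.
  pose e' := Num.min 1 (e / (m / rho * 2 ^+ d + 1)).
  have p0 : 0 < m / rho * 2 ^+ d + 1 by rewrite ltr_wpDl // mulr_ge0 // exprn_ge0.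
  have e'0 : 0 < e' by rewrite lt_min ltr01 divr_gt0.
  have := key e' _; rewrite e'0 ge_min lexx => /(_ isT)/le_trans; apply.
  rewrite -EFinD lee_fin mulrDr mulr1 lerD2l mulrA.
  apply: (@le_trans _ _ (m / rho * 2 ^+ d * (e / (m / rho * 2 ^+ d + 1)))).
    apply: ler_wpM2l; first by rewrite mulr_ge0 // exprn_ge0.
    by rewrite ge_min lexx orbT.
  by rewrite mulrA ler_pdivrMr // mulrC ler_pM2l //; lra.
have -> : (\int[leb d]_x (psi x)%:E =
   \int[leb d]_x limn (fun n : nat => (psi x * \1_(cube d (- n%:R) n%:R) x)%:E))%E.
  apply: eq_integral => x _; apply/esym/cvg_lim => //.
  apply: cvg_near_cst.
  exists (Num.truncn (\sum_(i < d) `|tnth x i|)).+1 => // n /= xn.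
  congr EFin; rewrite indicE mem_set ?mulr1 // => i.
  have : `|tnth x i| < n%:R.
    apply: le_lt_trans (_ : \sum_(i < d) `|tnth x i| < _).
      by rewrite (bigD1 i) //= lerDl sumr_ge0.
    by rewrite (lt_le_trans (truncnS_gt _)) // ler_nat.
  by rewrite ltr_norml.
have nd x : {homo (fun n : nat => (psi x * \1_(cube d (- n%:R) n%:R) x)%:E) :
    i j / (i <= j)%N >-> (i <= j)%E}.
  move=> i j ij; rewrite lee_fin ler_wpM2l // !indicE.
  case: (boolP (x \in cube d (- i%:R) _)) => // /set_mem xi.
  rewrite mem_set // => k; have := xi k.
  have : i%:R <= j%:R :> R by rewrite ler_nat.
  by lra.
have cv := @cvg_monotone_convergence _ _ R (leb d) setT measurableT
  (fun (n : nat) x => (psi x * \1_(cube d (- n%:R) n%:R) x)%:E).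
apply: (cvge_to_le (cv _ _ _)).
- by move=> n; apply/measurable_EFinP.
- by move=> n x _; rewrite lee_fin.
- by move=> x _; exact: nd.
- by exists 1%N => // n /= n0; apply: bound; rewrite ltr0n.
Qed.

End averaging.
Arguments spread_in {R d} N K s.
Arguments spread_bounded {R d} N psi m.

(** * Packings, well-spread sets and the isodiametric inequality *)

Section packing.
Context {R : realType} {d : nat} {N : d.-tuple R -> R} (HN : is_norm N).

Notation v := (leb d (nball N (vzero R d) 2^-1)).

Lemma leb_nball (x : d.-tuple R) (a : R) : 0 < a ->
  leb d (nball N x a) = (((2 * a) ^+ d)%:E * v)%E.
Proof.
move=> a0; rewrite -(nball_scale HN x) ?mulr_gt0 //.
by congr (leb d (nball N x _)); field.
Qed.


(** While [size s] times the volume of a ball of radius 2 stays below [K ^ d], such balls around [s]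
    cannot cover the cube, so a point at distance at least 2 from [s] can be added. If this never
    stopped, [s] could have any length, against the same volume bound. *)
Lemma greedy_density (K : R) : (v < +oo)%E -> 0 < K ->
  exists2 s, spread_in N K s & (fine (leb d (nball N (vzero R d) 2)))^-1 * K ^+ d <= (size s)%:R.
Proof.
move=> voo K0; set D := fine _.
have ballE x : leb d (nball N x 2) = D%:E.
  have fin : leb d (nball N (vzero R d) 2) \is a fin_num.
    by rewrite leb_nball // fin_numM // ge0_fin_numE.
  by rewrite leb_nball // -(leb_nball (vzero R d)) // fineK.
have D0 : 0 < D by rewrite -lte_fin -(ballE (vzero R d)) leb_nball_gt0.
apply: contrapT => nos.
have small s : spread_in N K s -> (size s)%:R * D < K ^+ d.
  move=> sK; rewrite ltNge; apply/negP => h; apply: nos; exists s => //.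
  by rewrite mulrC ler_pdivrMr.
have ext n : exists2 s, spread_in N K s & size s = n.
  elim: n => [|n [s sK sn]].
    by exists [::] => //; split.
  have [x [xK xs]] : exists x, cube d 0 K x /\ forall c, c \in s -> 2 <= N (vsub c x).
    apply: contrapT => nx; have := small s sK; apply/negP; rewrite -leNgt -lee_fin.
    have cov : cube d 0 K `<=` \big[setU/set0]_(c <- s) nball N c 2.
      move=> x xK; apply: contrapT => xs; apply: nx; exists x; split => // c cs.
      rewrite leNgt; apply/negP => cx; apply: xs; rewrite -bigcup_seq.
      by exists c.
    have mU : measurable (\big[setU/set0]_(c <- s) nball N c 2).
      by apply: bigsetU_measurable => c _; exact: measurable_nball.
    have := leb_cube d (ltW K0); rewrite subr0 => <-.
    apply: (@le_trans _ _ (leb d (\big[setU/set0]_(c <- s) nball N c 2))).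
      by apply: le_measureS => //; exact: measurable_cube.
    have : (leb d (\big[setU/set0]_(c <- s) nball N c 2) <= \sum_(c <- s) leb d (nball N c 2))%E.
      elim: s {sn sK cov mU nx} => [|c s IH]; first by rewrite !big_nil measure0.
      have mU : measurable (\big[setU/set0]_(c <- s) nball N c 2).
        by apply: bigsetU_measurable => c' _; exact: measurable_nball.
      rewrite !big_cons; apply: le_trans (measureU2 _ _ _) _ => //; first exact: measurable_nball.
      by rewrite leeD2l.
    move=> /le_trans; apply; under eq_bigr do rewrite ballE.
    by rewrite sumEFin lee_fin big_const_seq count_predT iter_addr_0 mulr_natl.
  case: sK => us ws sK.
  have xns : x \notin s.
    apply/negP => /xs; have -> : vsub x x = vzero R d by vring.
    by rewrite (normv0 HN); lra.
  exists (x :: s); last by rewrite /= sn.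
  split; first by rewrite /= xns.
    move=> a b /=; rewrite !inE => /orP[/eqP ->|sa] /orP[/eqP ->|sb] ab //.
    - by rewrite (normv_subC HN) (lt_le_trans _ (xs _ sb)) //; lra.
    - by rewrite (lt_le_trans _ (xs _ sa)) //; lra.
    - exact: ws.
  by move=> c; rewrite inE => /orP[/eqP ->|/sK].
have [s sK sn] := ext (Num.truncn (K ^+ d / D)).+1.
have := small s sK; rewrite sn -ltr_pdivlMr //; apply/negP; rewrite -leNgt.
by rewrite ltW // truncnS_gt.
Qed.

(** Centres closer than 2 would have their midpoint in both open balls. *)
Lemma admissible_packing_dist (K : R) S c c' : admissible_packing N K S ->
  c \in S -> c' \in S -> c != c' -> 2 <= N (vsub c c').
Proof.
move=> [_ [_ disj]] cS c'S cc'; rewrite leNgt; apply/negP => h.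
have : (translate c (unitB N) `&` translate c' (unitB N)) (vadd c (vscale 2^-1 (vsub c' c))).
  split.
    exists (vscale 2^-1 (vsub c' c)) => //; rewrite /unitB /nball /=.
    have -> : vsub (vzero R d) (vscale 2^-1 (vsub c' c)) = vscale 2^-1 (vsub c c') by vfield.
    by rewrite (normv_scale HN) ger0_norm ?invr_ge0 //; lra.
  exists (vscale 2^-1 (vsub c c')); last by vfield.
  rewrite /unitB /nball /=.
  have -> : vsub (vzero R d) (vscale 2^-1 (vsub c c')) = vscale (- 2^-1) (vsub c c') by vfield.
  by rewrite (normv_scale HN) normrN ger0_norm ?invr_ge0 //; lra.
by rewrite disj.
Qed.

Lemma vscale_inj (a : R) : a != 0 -> injective (@vscale R d a).
Proof.
move=> a0 x y xy; apply: tuple_eq => i.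
have := congr1 (fun t => tnth t i) xy; rewrite !tnth_mktuple.
by move/mulfI; apply.
Qed.

(** Well-spread sets need distances strictly above 1, whereas disjoint open balls only give centres
    at distance at least 2. The factor [l > 1] restores strictness, at the price of [l ^ d] in
    density. *)
Lemma packing_spread (K : R) S (l : R) : 1 < l -> admissible_packing N K S ->
  spread_in N (l / 2 * K) [seq vscale (l / 2) c | c <- S].
Proof.
move=> l1 SK; have [uS [SinK _]] := SK.
have l0 : 0 < l / 2 by lra.
split.
- by rewrite map_inj_uniq //; apply: vscale_inj; rewrite gt_eqF.
- move=> _ _ /mapP[a Sa ->] /mapP[b Sb ->] ab.
  have ab' : a != b by apply/eqP => e; apply: ab; rewrite e.
  have := admissible_packing_dist SK Sa Sb ab'.
  have -> : vsub (vscale (l / 2) a) (vscale (l / 2) b) = vscale (l / 2) (vsub a b) by vring.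
  rewrite (normv_scale HN) gtr0_norm // => h.
  have : l / 2 * 2 <= l / 2 * N (vsub a b) by rewrite ler_pM2l.
  by lra.
- move=> _ /mapP[a Sa ->] i; rewrite tnth_mktuple.
  by have /andP[a0 aK] := SinK a Sa i; rewrite mulr_gt0 //= ltr_pM2l.
Qed.

Lemma spread_packing (K : R) s : spread_in N K s ->
  admissible_packing N (2 * K) [seq vscale 2 c | c <- s].
Proof.
move=> [us ws sK]; split; first by rewrite map_inj_uniq //; apply: vscale_inj.
split.
  move=> _ /mapP[a sa ->] i; rewrite tnth_mktuple.
  by have /andP[a0 aK] := sK a sa i; rewrite mulr_gt0 //= ltr_pM2l.
move=> _ _ /mapP[a sa ->] /mapP[b sb ->] ab.
have {}ab : a <> b by move=> e; move/eqP: ab; apply; rewrite e.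
have := ws a b sa sb ab => ab1.
apply/seteqP; split => // x [[y y1 <-]] [z z1].
move: y1 z1; rewrite /unitB /nball /= => y1 z1 e.
have : N (vsub (vscale 2 a) (vscale 2 b)) <= N (vsub (vzero R d) y) + N (vsub (vzero R d) z).
  rewrite -(normv_opp HN (vsub _ z)); apply: le_trans (normv_add HN _ _).
  rewrite le_eqVlt; apply/orP; left; apply/eqP; congr N.
  apply: tuple_eq => i; have := congr1 (fun t => tnth t i) e; rewrite !tnth_mktuple; lra.
have -> : vsub (vscale 2 a) (vscale 2 b) = vscale 2 (vsub a b) by vring.
by rewrite (normv_scale HN) ger0_norm //; lra.
Qed.

Definition closed_nball (x : d.-tuple R) (rho : R) := [set y | N (vsub x y) <= rho].

Lemma measurable_closed_nball (x : d.-tuple R) (rho : R) : measurable (closed_nball x rho).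
Proof.
have -> : closed_nball x rho = (N \o vsub x) @^-1` `]-oo, rho]%classic.
  by apply/seteqP; split => y; rewrite /closed_nball /= in_itv.
rewrite -[X in measurable X]setTI.
by apply: (measurableT_comp (measurable_normv HN) (measurable_vsub x)).
Qed.

(** Comparison with the open balls of radius [a * (1 + t)] as [t] tends to 0; the sphere is never
    measured. *)
Lemma leb_closed_nball_le (x : d.-tuple R) (a : R) : 0 < a -> (v < +oo)%E ->
  (leb d (closed_nball x a) <= ((2 * a) ^+ d)%:E * v)%E.
Proof.
move=> a0 voo.
have vfin : v \is a fin_num by rewrite ge0_fin_numE.
rewrite -(fineK vfin) -EFinM; set V := fine v.
have V0 : 0 <= V by rewrite fine_ge0.
apply/lee_addgt0Pr => e e0.
pose c := (2 * a) ^+ d * V * 2 ^+ d.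
have c0 : 0 <= c by rewrite !mulr_ge0 // exprn_ge0 // mulr_ge0 // ltW.
pose t := Num.min 1 (e / (c + 1)).
have t0 : 0 < t by rewrite lt_min ltr01 divr_gt0 //; lra.
have t1 : t <= 1 by rewrite ge_min lexx.
have tc : c * t <= e.
  apply: (@le_trans _ _ (c * (e / (c + 1)))).
    by apply: ler_wpM2l => //; rewrite ge_min lexx orbT.
  by move: c0; move: (c) => c' c0; rewrite mulrA ler_pdivrMr ?ltr_wpDl //; nra.
apply: (@le_trans _ _ (leb d (nball N x (a * (1 + t))))).
  apply: le_measureS; [exact: measurable_closed_nball|exact: measurable_nball|].
  move=> y /le_lt_trans; apply; rewrite -subr_gt0.
  by rewrite (_ : a * (1 + t) - a = a * t) ?mulr_gt0 //; ring.
rewrite leb_nball; last by rewrite mulr_gt0 //; lra.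
rewrite -(fineK vfin) -/V -EFinM -EFinD lee_fin mulrA exprMn.
have /(@expr1D_le R d) h : 0 <= t <= 1 by rewrite ltW.
apply: (@le_trans _ _ ((2 * a) ^+ d * (1 + 2 ^+ d * t) * V)).
  by apply: ler_wpM2r => //; apply: ler_wpM2l => //; rewrite exprn_ge0 // mulr_ge0 // ltW.
rewrite (_ : (2 * a) ^+ d * (1 + 2 ^+ d * t) * V = (2 * a) ^+ d * V + c * t).
  by rewrite lerD2l.
by rewrite /c; ring.
Qed.

(* The isodiametric inequality in the multiplicative form given by Prekopa-Leindler. *)
Lemma leb_mul_le (A C : set (d.-tuple R)) : measurable A -> measurable C -> (v < +oo)%E ->
  (forall x y, A x -> C y -> N (vsub x y) <= 1) -> (leb d A * leb d C <= v * v)%E.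
Proof.
move=> mA mC voo AC.
have h2 : 0 < 2^-1 :> R by rewrite invr_gt0.
apply: (@le_trans _ _ (leb d (closed_nball (vzero R d) 2^-1) * leb d (closed_nball (vzero R d) 2^-1))%E); last first.
  have := leb_closed_nball_le (vzero R d) h2 voo.
  by rewrite divff // expr1n mul1e => h; apply: lee_pmul.
rewrite -!integral_indicT //; last exact: measurable_closed_nball.
apply: prekopa_leindler.
- exact/measurable_EFinP/measurable_indic.
- exact/measurable_EFinP/measurable_indic.
- by apply/measurable_EFinP/measurable_indic; exact: measurable_closed_nball.
- by move=> x; rewrite lee_fin.
- by move=> x; rewrite lee_fin.
- by move=> x; rewrite lee_fin.
move=> x y; rewrite -!EFinM lee_fin !indicE.
case: (boolP (x \in A)) => xA; last by rewrite mul0r mulr_ge0.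
case: (boolP (y \in C)) => yC; last by rewrite mulr0 mulr_ge0.
rewrite !inE in xA yC.
rewrite mem_set ?mulr1 //= /closed_nball /=.
have -> : vsub (vzero R d) (vscale 2^-1 (vsub x y)) = vscale (- 2^-1) (vsub x y) by vring.
rewrite (normv_scale HN) normrN ger0_norm ?invr_ge0 //.
by have := AC _ _ xA yC; lra.
Qed.

End packing.

(** * Exponential inequalities *)

Section exponential_inequalities.
Context {R : realType}.
Implicit Types (a b s x y p g t : R).

Lemma HfE p : Hf (expR p) = p * expR p - expR p + 1.
Proof. by rewrite /Hf expRK mulrC. Qed.

Lemma expR_tangent x y : expR x * (1 + (y - x)) <= expR y.
Proof.
have -> : expR y = expR x * expR (y - x) by rewrite -expRD addrC subrK.
by rewrite ler_pM2l ?expR_gt0 // expR_ge1Dx.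
Qed.

Lemma expR_tangent_lt x y : x != y -> expR x * (1 + (y - x)) < expR y.
Proof.
move=> xy; have -> : expR y = expR x * expR (y - x) by rewrite -expRD addrC subrK.
by rewrite ltr_pM2l ?expR_gt0 // expR_gt1Dx // subr_eq0 eq_sym.
Qed.

Lemma expR_chord (k r : R) : 0 <= k <= 1 -> expR (k * r) <= 1 + k * (expR r - 1).
Proof.
move=> /andP[k0 k1]; have := expR_tangent (k * r) r; have := expR_tangent (k * r) 0.
rewrite expR0; move: (expR (k * r)) (expR r) => A B h1 h2.
have : (1 - k) * (A * (1 + (0 - k * r))) <= (1 - k) * 1 by rewrite ler_wpM2l // subr_ge0.
have : k * (A * (1 + (r - k * r))) <= k * B by rewrite ler_wpM2l.
by lra.
Qed.

Lemma expR_chord_lt (k r : R) : 0 < k < 1 -> r != 0 -> expR (k * r) < 1 + k * (expR r - 1).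
Proof.
move=> /andP[k0 k1] r0; have := expR_tangent (k * r) r.
have kr0 : k * r != 0 by rewrite mulf_neq0 // gt_eqF.
have := expR_tangent_lt kr0.
rewrite expR0; move: (expR (k * r)) (expR r) => A B h1 h2.
have : (1 - k) * (A * (1 + (0 - k * r))) < (1 - k) * 1 by rewrite ltr_pM2l // subr_gt0.
have : k * (A * (1 + (r - k * r))) <= k * B by rewrite ler_pM2l.
by lra.
Qed.

(** The tangent to [expR] at [b], rearranged. Equality at [a = b] is what makes the minimum defining
    [xi] attained. *)
Lemma young_Hf a b : a * expR b <= Hf (expR b) + (expR a - 1).
Proof. by rewrite HfE; have := expR_tangent b a; lra. Qed.

(* Concavity of [w |-> w ^ (s / t)] on the chord [1, expR t]. *)
Lemma expR_ratio s t x : 0 < s <= t -> 0 <= x <= 1 ->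
  (expR (t * x) - 1) * (expR s - 1) <= (expR (s * x) - 1) * (expR t - 1).
Proof.
move=> /andP[s0 st] /andP[x0 x1].
have t0 : 0 < t by exact: lt_le_trans st.
have [k k01 sE] : exists2 k, 0 <= k <= 1 & s = k * t.
  exists (s / t); last by rewrite divfK // gt_eqF.
  by rewrite divr_ge0 ?(ltW s0) ?(ltW t0) //= ler_pdivrMr // mul1r.
(* tangent of w |-> w ^ k at w = expR (t * x), evaluated at w = 1 and w = expR t *)
have h1 : 1 <= expR (k * (t * x)) * (1 + k * (expR (- (t * x)) - 1)).
  apply: (@le_trans _ _ (expR (k * (t * x)) * expR (k * - (t * x)))).
    by rewrite -expRD mulrN subrr expR0.
  by rewrite ler_pM2l ?expR_gt0 // expR_chord.
have h2 : expR (k * t) <= expR (k * (t * x)) * (1 + k * (expR (t - t * x) - 1)).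
  apply: (@le_trans _ _ (expR (k * (t * x)) * expR (k * (t - t * x)))).
    by rewrite -expRD mulrBr addrC subrK.
  by rewrite ler_pM2l ?expR_gt0 // expR_chord.
rewrite sE -[k * t * x]mulrA.
rewrite expRD in h2; have e0 : 0 < expR (t * x) by exact: expR_gt0.
have eN : expR (t * x) * expR (- (t * x)) = 1 by rewrite -expRD subrr expR0.
move: h1 h2 e0 eN (expR_gt0 (k * (t * x))).
have : 1 <= expR (t * x) by rewrite -(expR0 R) ler_expR mulr_ge0 // ltW.
have : expR (t * x) <= expR t by rewrite ler_expR ler_piMr // ltW.
move: (expR (k * (t * x))) (expR (- (t * x))) (expR (t * x)) (expR t) (expR (k * t)) => A W w T K wT w1 h1 h2 e0 eN A0.
(* weights: w = ((T - w) 1 + (w - 1) T) / (T - 1) *)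
have : (T - w) * 1 <= (T - w) * (A * (1 + k * (W - 1))) by rewrite ler_wpM2l // subr_ge0.
have : (w - 1) * K <= (w - 1) * (A * (1 + k * (T * W - 1))) by rewrite ler_wpM2l // subr_ge0.
have -> : (w - 1) * (A * (1 + k * (T * W - 1))) = A * ((w - 1) * (1 - k) + k * (T * (w * W) - T * W)) by ring.
have -> : (T - w) * (A * (1 + k * (W - 1))) = A * ((T - w) * (1 - k) + k * (T * W - w * W)) by ring.
by rewrite eN; lra.
Qed.

Lemma Hf_ge0 p : 0 <= Hf (expR p).
Proof. by have := young_Hf 0 p; rewrite mul0r expR0 subrr addr0. Qed.

Lemma Hf_lipschitz x y : 0 <= x <= y -> Hf (expR y) - Hf (expR x) <= (y - x) * (y * expR y).
Proof.
move=> /andP[x0 xy]; rewrite !HfE; have := expR_tangent x y; have := expR_tangent y x.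
move: (expR x) (expR y) (expR_gt0 x) (expR_gt0 y) => A B A0 B0 h1 h2.
have : y * (B * (1 + (x - y))) <= y * A by rewrite ler_wpM2l // (le_trans x0).
by lra.
Qed.

Lemma Hf_tangent x y : 0 <= x -> Hf (expR x) + (y - x) * (x * expR x) <= Hf (expR y).
Proof.
move=> x0; rewrite !HfE; have := expR_tangent x y; have := expR_tangent y x.
move: (expR x) (expR y) (expR_gt0 x) (expR_gt0 y) => A B A0 B0 h1 h2.
have : x * (A * (1 + (y - x))) <= x * B by rewrite ler_wpM2l.
by lra.
Qed.

Lemma Hf_nondecreasing x y : 0 <= x <= y -> Hf (expR x) <= Hf (expR y).
Proof.
move=> /andP[x0 xy]; apply: le_trans (Hf_tangent y x0); rewrite lerDl.
by rewrite !mulr_ge0 ?subr_ge0 // ltW // expR_gt0.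
Qed.

(** [Hf (expR _)] is convex on the nonnegative half-line and vanishes at 0. *)
Lemma Hf_star s x : 1 <= s -> 0 <= x -> s * Hf (expR x) <= Hf (expR (s * x)).
Proof.
move=> s1 x0; have h1 := Hf_tangent (s * x) x0.
have h2 : Hf (expR x) <= x * (x * expR x).
  by have := @Hf_lipschitz 0 x; rewrite lexx x0 => /(_ isT); rewrite [X in _ - X]HfE expR0 mul0r subr0; lra.
apply: le_trans h1.
have : (s - 1) * Hf (expR x) <= (s - 1) * (x * (x * expR x)) by rewrite ler_wpM2l // subr_ge0.
by lra.
Qed.

Lemma Hf_chord s x : 0 <= s -> 0 <= x <= 1 -> Hf (expR (s * x)) <= x * Hf (expR s).
Proof.
move=> s0 /andP[x0 x1]; move: x0; rewrite le_eqVlt => /orP[/eqP <-|x0].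
  by rewrite mulr0 HfE expR0; lra.
have i1 : 1 <= x^-1 by rewrite invf_ge1.
have := Hf_star i1 (mulr_ge0 s0 (ltW x0)).
by rewrite [x^-1 * (s * x)]mulrC mulfK ?gt_eqF // ler_pdivrMl.
Qed.

(** The function [expR (2 * ln K * _)] takes the values 1, [K] and [K ^ 2] at 0, 1/2 and 1;
    [Num.min] and [Num.max] combine its two chords in one formula. *)
Lemma half_chord (K x : R) : 1 < K -> 0 <= x <= 1 ->
  expR (2 * ln K * x) - 1 <= 2 * (K - 1) * (Num.min x 2^-1 + K * Num.max 0 (x - 2^-1)).
Proof.
move=> K1 /andP[x0 x1]; have K0 : 0 < K by lra.
have [xh|xh] := leP x 2^-1.
  rewrite max_l ?subr_le0 // mulr0 addr0.
  have := @expR_chord (2 * x) (ln K); rewrite lnK ?posrE // => /(_ _) h.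
  have -> : 2 * ln K * x = 2 * x * ln K by ring.
  by apply: le_trans (_ : 2 * x * (K - 1) <= _); [rewrite lerBlDl h //; lra|lra].
rewrite max_r; last by rewrite subr_ge0 ltW.
have := @expR_chord (2 * x - 1) (ln K); rewrite lnK ?posrE // => /(_ _) h.
have -> : 2 * ln K * x = ln K + (2 * x - 1) * ln K by ring.
rewrite expRD lnK ?posrE //.
have : K * expR ((2 * x - 1) * ln K) <= K * (1 + (2 * x - 1) * (K - 1)) by rewrite ler_pM2l // h //; lra.
by lra.
Qed.

(* The factor [Hf (expR p) / expR p]. *)
Definition kf p := p - 1 + expR (- p).

Lemma Hf_kf p : Hf (expR p) = expR p * kf p.
Proof.
rewrite HfE /kf mulrDr mulrBr mulr1 -expRD subrr expR0; ring.
Qed.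

Lemma kf_lt p p' : 0 <= p' < p -> kf p' < kf p.
Proof.
move=> /andP[p0 pp]; have := @expR_tangent_lt (- p') (- p).
rewrite eqr_opp lt_eqF // => /(_ isT); rewrite /kf.
have : expR (- p') <= 1 by rewrite -(expR0 R) ler_expR; lra.
move: (expR (- p')) (expR (- p)) => A B A1 h.
have : 0 <= (1 - A) * (p - p') by rewrite mulr_ge0 // subr_ge0 // ltW.
by lra.
Qed.

Lemma kf_gt0 p : 0 < p -> 0 < kf p.
Proof. by move=> p0; have := @kf_lt p 0; rewrite lexx p0 => /(_ isT); rewrite {1}/kf oppr0 expR0; lra. Qed.

Lemma Hf_gt0 p : 0 < p -> 0 < Hf (expR p).
Proof. by move=> p0; rewrite Hf_kf mulr_gt0 ?expR_gt0 ?kf_gt0. Qed.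

(** The difference of the two sides is [g - (1 - expR (- g))] times [kf p - kf p'], plus
    [1 - expR (- g)] times [p * (1 - expR (- p')) - p' * (1 - expR (- p))]. The last factor is
    positive because [(1 - expR (- p)) / p] decreases in [p]. *)
Lemma kf_log_concave p p' g : 0 < p' < p -> 0 < g ->
  kf (p + g) * kf p' < kf (p' + g) * kf p.
Proof.
move=> /andP[p'0 pp] g0; have p0 : 0 < p by exact: lt_trans pp.
have Y0 : 0 < p - p' - (expR (- p') - expR (- p)).
  by have := @kf_lt p p'; rewrite ltW // pp => /(_ isT); rewrite /kf; lra.
have X0 : 0 < p * (1 - expR (- p')) - p' * (1 - expR (- p)).
  have := @expR_chord_lt (p' / p) (- p).
  rewrite divr_gt0 // ltr_pdivrMr // mul1r pp oppr_eq0 gt_eqF // => /(_ isT isT).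
  rewrite mulrN divfK ?gt_eqF // => h.
  have : p * expR (- p') < p * (1 + p' / p * (expR (- p) - 1)) by rewrite ltr_pM2l.
  rewrite (_ : p * (1 + _) = p + p' * (expR (- p) - 1)); first by lra.
  by field; rewrite gt_eqF.
have c0 : 0 < 1 - expR (- g) by rewrite subr_gt0 -[ltRHS](expR0 R) ltr_expR oppr_lt0.
have cg : 1 - expR (- g) < g by have := @expR_gt1Dx R (- g); rewrite oppr_eq0 gt_eqF // => /(_ isT); lra.
rewrite /kf !opprD !expRD.
move: c0 cg X0 Y0; move: (expR (- g)) (expR (- p)) (expR (- p')) => G u u' c0 cg X0 Y0.
rewrite -subr_gt0.
have -> : (p' + g - 1 + u' * G) * (p - 1 + u) - (p + g - 1 + u * G) * (p' - 1 + u') =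
  (g - (1 - G)) * (p - p' - (u' - u)) + (1 - G) * (p * (1 - u') - p' * (1 - u)) by ring.
by rewrite addr_gt0 // mulr_gt0 // subr_gt0.
Qed.

Lemma Hf_log_concave p p' g : 0 < p' < p -> 0 < g ->
  Hf (expR (p + g)) * Hf (expR p') < Hf (expR (p' + g)) * Hf (expR p).
Proof.
move=> pp g0; rewrite !Hf_kf !expRD.
have := kf_log_concave pp g0; move: (kf (p + g)) (kf p') (kf (p' + g)) (kf p) => a b c e abce.
rewrite [ltLHS](_ : _ = expR p * expR g * expR p' * (a * b)); last by ring.
rewrite [ltRHS](_ : _ = expR p * expR g * expR p' * (c * e)); last by ring.
by rewrite ltr_pM2l // !mulr_gt0 ?expR_gt0.
Qed.

Lemma continuous_Hf_expR : continuous (fun p => Hf (expR p)).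
Proof.
move=> p; rewrite (_ : (fun _ => _) = fun p => p * expR p - expR p + 1).
  apply: cvgD; last exact: cvg_cst.
  apply: cvgB; last exact: continuous_expR.
  by apply: cvgM; [exact: cvg_id|exact: continuous_expR].
by apply/funext => q; rewrite HfE.
Qed.

Lemma continuous_kf : continuous kf.
Proof.
move=> p; apply: cvgD; first by apply: cvgB; [exact: cvg_id|exact: cvg_cst].
apply: (@continuous_comp _ _ _ -%R expR); first exact: opp_continuous.
exact: continuous_expR.
Qed.

Lemma positive_root (f : R -> R) t : continuous f -> f 0 = 0 -> 0 < t ->
  (exists2 M, 0 < M & t <= f M) -> exists2 p, 0 < p & f p = t.
Proof.
move=> cf f0 t0 [M M0 fM].
have [||p] := @IVT R f 0 M t (ltW M0).
- by apply: continuous_subspaceT => x; exact: cf.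
- by rewrite f0 minEle maxEle (le_trans (ltW t0) fM) ltW.
rewrite in_itv /= => /andP[p0 _] fp; exists p => //.
by rewrite lt_neqAle p0 andbT; apply: contraPneq fp => <-; rewrite f0; apply/eqP; rewrite lt_eqF.
Qed.

Lemma Hf_root t : 0 < t -> exists2 p, 0 < p & Hf (expR p) = t.
Proof.
move=> t0; apply: positive_root => //; first exact: continuous_Hf_expR.
  by rewrite HfE expR0; lra.
exists (t + 2); first by lra.
rewrite Hf_kf; have e1 : 1 <= expR (t + 2) by have := expR_ge1Dx (t + 2); lra.
have k1 : t + 1 <= kf (t + 2) by rewrite /kf; have := expR_gt0 (- (t + 2)); lra.
by rewrite -[leLHS]mul1r ler_pM //; lra.
Qed.

Lemma kf_root t : 0 < t -> exists2 p, 0 < p & kf p = t.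
Proof.
move=> t0; apply: positive_root => //; first exact: continuous_kf.
  by rewrite /kf oppr0 expR0; lra.
exists (t + 1); first by lra.
by rewrite /kf; have := expR_gt0 (- (t + 1)); lra.
Qed.

End exponential_inequalities.

(** * The weighted integral of one function *)

Section weighted_integral.
Context {R : realType} {d : nat} (phi : d.-tuple R -> R).

Lemma integE (f : d.-tuple R -> R) : measurable_fun setT f -> (forall x, 0 <= f x) ->
  integ f = (\int[leb d]_x (f x)%:E)%E.
Proof.
by move=> mf f0; rewrite /integ iintE //; exact/measurable_EFinP.
Qed.

Definition rint (f : d.-tuple R -> R) : R := fine (\int[leb d]_x (f x)%:E)%E.

Hypotheses (mphi : measurable_fun setT phi) (phi01 : forall x, 0 <= phi x <= 1)
  (phioo : (\int[leb d]_x (phi x)%:E < +oo)%E).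

Let phi0 x : 0 <= phi x. Proof. by case/andP: (phi01 x). Qed.
Let phi1 x : phi x <= 1. Proof. by case/andP: (phi01 x). Qed.

(** On this class all integrals are finite, so the real-valued [rint] is additive, homogeneous and
    monotone there. *)
Definition dominated (f : d.-tuple R -> R) :=
  [/\ measurable_fun setT f, (forall x, 0 <= f x) &
      exists c, forall x, f x <= c * phi x].

Lemma rintE f : dominated f -> (rint f)%:E = (\int[leb d]_x (f x)%:E)%E.
Proof.
move=> [mf f0 [c fc]]; rewrite /rint fineK // ge0_fin_numE; last first.
  by apply: integral_ge0 => x _; rewrite lee_fin.
apply: (@le_lt_trans _ _ (\int[leb d]_x (`|c|%:E * (phi x)%:E))%E).
  apply: ge0_le_integral => //.
  - by move=> x _; rewrite lee_fin.
  - exact/measurable_EFinP.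
  - by apply: measurable_funeM; exact/measurable_EFinP.
  - move=> x _; rewrite -EFinM lee_fin (le_trans (fc x)) // ler_wpM2r //; exact: ler_norm.
rewrite ge0_integralZl_EFin //; last exact/measurable_EFinP.
  by rewrite lte_mul_pinfty // ?lee_fin // ge0_fin_numE.
by move=> x _; rewrite lee_fin.
Qed.

Lemma dominatedD f g : dominated f -> dominated g -> dominated (fun x => f x + g x).
Proof.
move=> [mf f0 [c fc]] [mg g0 [e ge]]; split.
- exact: measurable_funD.
- by move=> x; rewrite addr_ge0.
- by exists (c + e) => x; rewrite mulrDl lerD.
Qed.

Lemma dominatedZ a f : 0 <= a -> dominated f -> dominated (fun x => a * f x).
Proof.
move=> a0 [mf f0 [c fc]]; split.
- exact: measurable_funM.
- by move=> x; rewrite mulr_ge0.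
- by exists (a * c) => x; rewrite -mulrA ler_wpM2l.
Qed.

Lemma rintD f g : dominated f -> dominated g -> rint (fun x => f x + g x) = rint f + rint g.
Proof.
move=> df dg; apply: EFin_inj; rewrite EFinD !rintE //; last exact: dominatedD.
case: df dg => [mf f0 _] [mg g0 _].
under eq_integral do rewrite EFinD.
rewrite ge0_integralD //; try exact/measurable_EFinP.
- by move=> x _; rewrite lee_fin.
- by move=> x _; rewrite lee_fin.
Qed.

Lemma rintZ a f : 0 <= a -> dominated f -> rint (fun x => a * f x) = a * rint f.
Proof.
move=> a0 df; apply: EFin_inj; rewrite EFinM !rintE //; last exact: dominatedZ.
case: df => [mf f0 _]; under eq_integral do rewrite EFinM.
by rewrite ge0_integralZl_EFin //; [move=> x _; rewrite lee_fin|exact/measurable_EFinP].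
Qed.

Lemma ler_rint f g : dominated f -> dominated g -> (forall x, f x <= g x) -> rint f <= rint g.
Proof.
move=> df dg fg; rewrite -lee_fin !rintE //.
case: df dg => [mf f0 _] [mg g0 _].
apply: ge0_le_integral => //; try exact/measurable_EFinP.
- by move=> x _; rewrite lee_fin.
- by move=> x _; rewrite lee_fin.
Qed.

Lemma rint_ge0 f : dominated f -> 0 <= rint f.
Proof.
move=> df; rewrite -lee_fin rintE //; apply: integral_ge0 => x _; rewrite lee_fin.
by case: df.
Qed.

Definition Phi (s : R) := rint (fun x => expR (s * phi x) - 1).
Definition HPhi (s : R) := rint (fun x => Hf (expR (s * phi x))).

Lemma dominated_phi : dominated phi.
Proof. by split => //; exists 1 => x; rewrite mul1r. Qed.

Let mexp (s : R) : measurable_fun setT (fun x => expR (s * phi x)).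
Proof. by apply: measurableT_comp => //; exact: measurable_funM. Qed.

Lemma dominated_expR1 s : 0 <= s -> dominated (fun x => expR (s * phi x) - 1).
Proof.
move=> s0; split.
- exact: measurable_funB.
- by move=> x; rewrite subr_ge0 -[leLHS](expR0 R) ler_expR mulr_ge0.
- exists (expR s - 1) => x; have := expR_chord s (phi01 x).
  by rewrite [phi x * s]mulrC; lra.
Qed.

Lemma dominated_Hf s : 0 <= s -> dominated (fun x => Hf (expR (s * phi x))).
Proof.
move=> s0; split.
- rewrite (_ : (fun _ => _) = fun x => s * phi x * expR (s * phi x) - expR (s * phi x) + 1).
    apply: measurable_funD => //; apply: measurable_funB => //.
    by apply: measurable_funM => //; exact: measurable_funM.
  by apply/funext => x; rewrite HfE.
- by move=> x; exact: Hf_ge0.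
- by exists (Hf (expR s)) => x; rewrite [leRHS]mulrC; exact: Hf_chord.
Qed.

Lemma dominated_phi_expR s : 0 <= s -> dominated (fun x => phi x * expR (s * phi x)).
Proof.
move=> s0; split.
- exact: measurable_funM.
- by move=> x; rewrite mulr_ge0 // expR_ge0.
- by exists (expR s) => x; rewrite [leRHS]mulrC ler_wpM2l // ler_expR ler_piMr.
Qed.

Lemma Phi_chord s : 0 <= s -> Phi s <= rint phi * (expR s - 1).
Proof.
move=> s0; have e1 : 0 <= expR s - 1 by rewrite subr_ge0 -[leLHS](expR0 R) ler_expR.
rewrite mulrC -rintZ //; last exact: dominated_phi.
apply: ler_rint; [exact: dominated_expR1|exact/dominatedZ/dominated_phi|].
by move=> x; have := expR_chord s (phi01 x); rewrite [phi x * s]mulrC; lra.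
Qed.

Lemma Phi_ratio s t : 0 < s <= t -> Phi t * (expR s - 1) <= Phi s * (expR t - 1).
Proof.
move=> /andP[s0 st]; have t0 := lt_le_trans s0 st.
have e1 : 0 <= expR s - 1 by rewrite subr_ge0 -[leLHS](expR0 R) ler_expR ltW.
have e2 : 0 <= expR t - 1 by rewrite subr_ge0 -[leLHS](expR0 R) ler_expR ltW.
have ds := dominated_expR1 (ltW s0); have dt := dominated_expR1 (ltW t0).
rewrite mulrC -rintZ // [leRHS]mulrC -rintZ //.
apply: ler_rint; [exact: dominatedZ|exact: dominatedZ|].
move=> x; rewrite mulrC [leRHS]mulrC; apply: expR_ratio => //.
by rewrite s0.
Qed.

Lemma HPhi_lipschitz s t : 0 <= s <= t ->
  HPhi s <= HPhi t <= HPhi s + (t - s) * (t * expR t * rint phi).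
Proof.
move=> /andP[s0 st]; have t0 := le_trans s0 st; apply/andP; split.
  apply: ler_rint; [exact: dominated_Hf..|].
  by move=> x; apply: Hf_nondecreasing; rewrite mulr_ge0 //= ler_wpM2r.
have c0 : 0 <= (t - s) * (t * expR t) by rewrite !mulr_ge0 ?subr_ge0 // expR_ge0.
rewrite mulrA -rintZ //; last exact: dominated_phi.
have dZ := dominatedZ c0 dominated_phi; have ds := dominated_Hf s0.
rewrite -rintD //; apply: ler_rint; [exact: dominated_Hf|exact: dominatedD|].
move=> x; rewrite -lerBlDl; apply: (@le_trans _ _ ((t * phi x - s * phi x) * (t * phi x * expR (t * phi x)))).
  by apply: Hf_lipschitz; rewrite mulr_ge0 //= ler_wpM2r.
rewrite [leLHS](_ : _ = (t - s) * phi x * (t * (phi x * expR (t * phi x)))); last by ring.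
rewrite [leRHS](_ : _ = (t - s) * phi x * (t * expR t)); last by ring.
apply: ler_wpM2l; first by rewrite mulr_ge0 // subr_ge0.
apply: ler_wpM2l => //; rewrite -[leRHS]mul1r.
apply: (ler_pM (phi0 x) (expR_ge0 _) (phi1 x)).
by rewrite ler_expR ler_piMr.
Qed.

(** The Lipschitz estimate is for [s >= 0]; the absolute value extends the function continuously to
    the whole line, as [positive_root] requires. *)
Lemma continuous_HPhi_norm : continuous (fun s : R => HPhi `|s|).
Proof.
move=> s; apply/cvgrPdist_lt => e e0.
pose m := `|s| + 1; pose L := m * expR m * rint phi.
have L0 : 0 <= L.
  by rewrite !mulr_ge0 ?expR_ge0 ?addr_ge0 // rint_ge0 //; exact: dominated_phi.
have lip a b : 0 <= a <= b -> b <= m -> HPhi a <= HPhi b <= HPhi a + (b - a) * L.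
  move=> ab bm; have /andP[h0 h] := HPhi_lipschitz ab; rewrite h0 andTb {h0}.
  case/andP: ab => a0 ab; have b0 := le_trans a0 ab.
  apply: (le_trans h); rewrite lerD2l ler_wpM2l ?subr_ge0 //.
  rewrite /L; apply: ler_wpM2r; first by apply: rint_ge0; exact: dominated_phi.
  by apply: (ler_pM b0 (expR_ge0 _) bm); rewrite ler_expR.
have r0 : 0 < Num.min 1 (e / (L + 1)) by rewrite lt_min ltr01 divr_gt0 // ltr_wpDl.
near=> t.
have : `|s - t| < Num.min 1 (e / (L + 1)).
  by near: t; exact: (@cvgr_dist_lt _ _ _ (nbhs s) _ id).
rewrite lt_min => /andP[st1 st2].
have tm : `|t| <= m.
  have -> : t = s - (s - t) by ring.
  by apply: le_trans (ler_normB _ _) _; rewrite lerD2l ltW.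
have sm : `|s| <= m by rewrite lerDl.
have dst : `| `|s| - `|t| | <= `|s - t| by exact: ler_dist_dist.
have stL : `|s - t| * L < e.
  by move: st2; rewrite ltr_pdivlMr ?ltr_wpDl // => st2; have := normr_ge0 (s - t); nra.
have dL : `| `|s| - `|t| | * L <= `|s - t| * L by exact: ler_wpM2r.
apply: le_lt_trans stL; apply: le_trans dL.
have [st|/ltW ts] := leP `|s| `|t|.
  have := lip `|s| `|t|; rewrite normr_ge0 st => /(_ isT tm) /andP[h1 h2].
  rewrite (_ : `|HPhi _ - _| = HPhi `|t| - HPhi `|s|); last first.
    by rewrite distrC ger0_norm // subr_ge0.
  rewrite (_ : `| `|s| - `|t| | = `|t| - `|s|); last first.
    by rewrite distrC ger0_norm // subr_ge0.
  by rewrite lerBlDl.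
have := lip `|t| `|s|; rewrite normr_ge0 ts => /(_ isT sm) /andP[h1 h2].
rewrite (_ : `|HPhi _ - _| = HPhi `|s| - HPhi `|t|); last by rewrite ger0_norm // subr_ge0.
rewrite (_ : `| `|s| - `|t| | = `|s| - `|t|); last by rewrite ger0_norm // subr_ge0.
by rewrite lerBlDl.
Unshelve. all: by end_near. Qed.

Hypothesis phi_pos : 0 < rint phi.

(** A zero integral would force [Hf (expR (phi x)) = 0], hence [phi x = 0], almost everywhere. *)
Lemma HPhi1_gt0 : 0 < HPhi 1.
Proof.
have dH : dominated (fun x => Hf (expR (1 * phi x))) by apply: dominated_Hf.
rewrite lt_neqAle rint_ge0 // andbT eq_sym; apply/negP => /eqP H0.
have [mH _ _] := dH.
have mHE : measurable_fun setT (EFin \o (fun x => Hf (expR (1 * phi x)))).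
  exact/measurable_EFinP.
have [h _] := ae_eq_integral_abs (leb d) measurableT mHE.
have : ae_eq (leb d) setT (EFin \o (fun x => Hf (expR (1 * phi x)))) (cst 0%E).
  apply: h; rewrite -[RHS]/(0%:E) -H0 /HPhi rintE //.
  by apply: eq_integral => x _ /=; rewrite ger0_norm // Hf_ge0.
move=> ae.
have : ae_eq (leb d) setT (EFin \o phi) (cst 0%E).
  apply: filterS ae => x /= /(_ Logic.I) [] hx _; congr EFin.
  apply/eqP; rewrite eq_le phi0 andbT leNgt; apply/negP => px.
  by have := Hf_gt0 px; rewrite mul1r in hx; rewrite hx ltxx.
have mphiE : measurable_fun setT (EFin \o phi) by exact/measurable_EFinP.
move/(ae_eq_integral _ _ measurableT mphiE (measurable_cst _)) => h0.
move: phi_pos; rewrite -lte_fin rintE; last exact: dominated_phi.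
by rewrite [X in (_ < X)%E]h0 integral0 ltxx.
Qed.

Lemma s_par_spec (t : R) : 0 < t -> 0 < s_par phi t /\ HPhi (s_par phi t) = t^-1.
Proof.
move=> t0; have H1 := HPhi1_gt0.
have ti0 : 0 < t^-1 by rewrite invr_gt0.
have HP0 : HPhi 0 = 0.
  rewrite /HPhi (_ : (fun _ => _) = fun=> 0); first by rewrite /rint integral0.
  by apply/funext => x; rewrite mul0r HfE expR0; lra.
have [s s0 sE] : exists2 s, 0 < s & HPhi `|s| = t^-1.
  apply: (positive_root continuous_HPhi_norm _ ti0).
    by rewrite normr0.
  (* By star-shapedness [HPhi m >= m * HPhi 1], so this [m] reaches the level [1 / t]. *)
  pose m := Num.max 1 (t^-1 / HPhi 1).
  have m1 : 1 <= m by rewrite le_max lexx.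
  have m0 : 0 < m by exact: lt_le_trans m1.
  exists m; first exact: m0.
  rewrite (gtr0_norm m0).
  apply: (@le_trans _ _ (m * HPhi 1)).
    by rewrite -ler_pdivrMr // le_max lexx orbT.
  have d1 : dominated (fun x => Hf (expR (1 * phi x))) by apply: dominated_Hf.
  rewrite /HPhi -(rintZ (ltW m0) d1); apply: ler_rint.
  - by apply: dominatedZ => //; exact: ltW.
  - by apply: dominated_Hf; exact: ltW.
  - by move=> x; rewrite mul1r; exact: Hf_star.
have P s' : 0 <= s' -> integ (fun x => Hf (expR (s' * phi x))) = (HPhi s')%:E.
  by move=> s'0; have dH := dominated_Hf s'0; rewrite rintE //; case: dH => mH H0 _; exact: integE.
have [sp0 spE] : 0 <= s_par phi t /\ integ (fun x => Hf (expR (s_par phi t * phi x))) = (t^-1)%:E.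
  rewrite /s_par; apply: (@xgetPex _ 0 [set s | 0 <= s /\ integ (fun x => Hf (expR (s * phi x))) = (t^-1)%:E]).
  by exists s; split; [exact: ltW|rewrite P ?ltW // -sE gtr0_norm].
rewrite P // in spE; case: spE => spE; split => //.
rewrite lt_neqAle sp0 andbT; apply/eqP => e; move: spE; rewrite -e HP0 => h.
by rewrite -h ltxx in ti0.
Qed.

(** Integrating [young_Hf] gives the bound for every [r], and its equality case gives [r = s]. The
    later comparisons of curves rest on these relations. *)
Lemma xi_spec (t : R) : 0 < t -> exists X s, [/\ xi phi t = X%:E, 0 < s,
  s * X = t^-1 + Phi s, (forall r, 0 < r -> r * X <= t^-1 + Phi r) & rint phi <= X].
Proof.
move=> t0; have [s0 sE] := s_par_spec t0; set s := s_par phi t in s0 sE.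
have dX := dominated_phi_expR (ltW s0).
have dH := dominated_Hf (ltW s0); have dP := dominated_expR1 (ltW s0).
exists (rint (fun x => phi x * expR (s * phi x))), s; split => //.
- rewrite /xi -/s ifF.
    by rewrite rintE //; case: dX => mX X0 _; exact: integE.
  rewrite integE // -rintE; last exact: dominated_phi.
  by rewrite eqe gt_eqF.
- rewrite -(rintZ (ltW s0) dX) -sE /HPhi /Phi -rintD //; congr rint.
  by apply/funext => x; rewrite HfE; ring.
- move=> r r0; have dr := dominated_expR1 (ltW r0).
  rewrite -(rintZ (ltW r0) dX) -sE /HPhi /Phi -rintD //; apply: ler_rint.
  + by apply: dominatedZ => //; exact: ltW.
  + exact: dominatedD.
  + by move=> x; have := young_Hf (r * phi x) (s * phi x); rewrite mulrA.
- apply: ler_rint => //; first exact: dominated_phi.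
  move=> x; rewrite ler_peMr // -[leLHS](expR0 R) ler_expR mulr_ge0 // ltW //.
Qed.

End weighted_integral.

(** * Feasible functions and the packing density *)

Section feasibility.
Context {R : realType} {d : nat} {N : d.-tuple R -> R} (HN : is_norm N).

Notation v := (leb d (nball N (vzero R d) 2^-1)).

(** A sum over a set is the supremum of its finite partial sums, and subsets of well-spread sets are
    well-spread. *)
Lemma feasibleP (phi : d.-tuple R -> R) : feasible N phi <->
  [/\ measurable_fun setT phi, (forall x, 0 <= phi x) & spread_bounded N phi 1].
Proof.
split=> [[mphi [phi0 phiS]]|[mphi phi0 phiS]].
  split => // s us ws; rewrite -lee_fin; apply: le_trans (phiS _ ws).
  rewrite esum_fset; [|exact: finite_seq|by move=> i _; rewrite lee_fin].
  by rewrite -fsbig_seq // sumEFin.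
split; [exact: mphi|split; [exact: phi0|move=> S wS]]; apply: ge_ereal_sup => _ [A [fA AS] <-].
rewrite fsbig_finite //= sumEFin lee_fin; apply: phiS.
  exact: finmap.fset_uniq.
move=> a b /= Aa Ab; apply: wS; apply: AS; apply/set_mem.
  by rewrite -in_fset_set.
by rewrite -in_fset_set.
Qed.

Lemma spread_bounded_le (phi : d.-tuple R -> R) m x :
  (forall x, 0 <= phi x) -> spread_bounded N phi m -> phi x <= m.
Proof.
move=> phi0 phim; have := phim [:: x]; rewrite big_seq1; apply => //.
by move=> a b /=; rewrite !inE => /eqP -> /eqP -> /(_ erefl).
Qed.

Lemma feasible_01 phi : feasible N phi -> forall x, 0 <= phi x <= 1.
Proof.
by move=> /feasibleP[_ phi0 phiS] x; rewrite phi0 (spread_bounded_le _ _ phiS).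
Qed.

Lemma feasible_half_ball : feasible N (\1_(nball N (vzero R d) 2^-1) : _ -> R).
Proof.
apply/feasibleP; split => //.
  by apply: measurable_indic; exact: measurable_nball.
set B := nball N _ _ => s us ws.
have [[a sa Ba]|nB] := pselect (exists2 a, a \in s & B a); last first.
  rewrite big_seq big1 // => a sa; rewrite indicE memNset // => Ba; apply: nB.
  by exists a.
rewrite (bigD1_seq a) //= [X in _ + X]big1_seq ?addr0 ?indicE ?lern1 ?leq_b1 //.
move=> b /andP[ba sb]; rewrite indicE memNset // => Bb.
have := ws a b sa sb; rewrite ltNge.
have -> : N (vsub a b) <= 1.
  apply: le_trans (normv_sub_trans HN (vzero R d) _ _) _.
  by move: Ba Bb; rewrite /B /nball /= (normv_subC HN a); lra.
by move=> h; have /h : a <> b by move=> e; move/eqP: ba; apply.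
Qed.

(** The greedy density is enough for a constant uniform in [psi]. The bound [m] stays general
    because it will be small for the part of a feasible function far from its near-maximum. *)
Lemma feasible_integral_bound : (v < +oo)%E -> exists2 C : R, 0 < C &
  forall (psi : d.-tuple R -> R) (m : R), measurable_fun setT psi -> (forall x, 0 <= psi x) ->
    spread_bounded N psi m -> 0 <= m -> (\int[leb d]_x (psi x)%:E <= (m * C)%:E)%E.
Proof.
move=> voo; set D := fine (leb d (nball N (vzero R d) 2)).
have D0 : 0 < D.
  rewrite -lte_fin fineK ?leb_nball_gt0 //.
  by rewrite leb_nball // fin_numM // ge0_fin_numE.
exists D => // psi m mpsi psi0 bpsi m0.
rewrite -[X in (m * X)%:E]invrK; have Di : 0 < D^-1 by rewrite invr_gt0.
apply: averaging mpsi psi0 bpsi m0 Di _.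
move=> K0; exists (Num.max K0 1); first by rewrite le_max lexx.
by apply: greedy_density => //; rewrite lt_max ltr01 orbT.
Qed.

Lemma vol_unitB : vol (unitB N) = ((2 ^+ d)%:E * v)%E.
Proof.
rewrite volE; last exact: measurable_nball.
by rewrite /unitB leb_nball // mulr1.
Qed.

Lemma packnum_ge1 (K : R) : 0 < K -> (1 <= packnum N K)%E.
Proof.
move=> K0; apply: ereal_sup_ubound; exists [:: [tuple K / 2 | i < d]] => //; split => //.
split => [c|c c' ]; rewrite !inE => /eqP ->.
  by move=> i; rewrite tnth_mktuple; lra.
by move=> /eqP ->; rewrite eqxx.
Qed.

(** One translate always fits, so a ball of infinite volume would make every ratio infinite. *)
Lemma finite_ball (l : R) : pack_ratio N x @[x --> +oo] --> l%:E -> (v < +oo)%E.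
Proof.
move=> cl; rewrite ltey; apply/eqP => voo.
have : pack_ratio N x @[x --> +oo] --> +oo%E.
  apply: cvg_near_cst; near=> K.
  have K0 : 0 < K by near: K; exact: nbhs_pinfty_gt.
  rewrite /pack_ratio vol_unitB voo gt0_muley ?lte_fin ?exprn_gt0 //.
  rewrite gt0_muley ?gt0_mulye ?lte_fin ?invr_gt0 ?exprn_gt0 //.
  by apply: lt_le_trans (packnum_ge1 K0).
by move=> /(cvg_unique (@ereal_hausdorff R) cl).
Unshelve. all: by end_near. Qed.

Lemma packing_of_ratio (K q : R) : 0 < K -> (v < +oo)%E ->
  (q%:E < pack_ratio N K)%E ->
  exists2 S, admissible_packing N K S & q * K ^+ d < (size S)%:R * (2 ^+ d * fine v).
Proof.
move=> K0 voo; rewrite /pack_ratio vol_unitB.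
have vfin : v \is a fin_num by rewrite ge0_fin_numE.
have v0 : 0 < fine v by rewrite -lte_fin fineK ?leb_nball_gt0.
rewrite -[in X in X -> _](fineK vfin) -EFinM -muleA -EFinM.
have Kd : 0 < K ^+ d by rewrite exprn_gt0.
have c0 : 0 < 2 ^+ d * fine v / K ^+ d by rewrite divr_gt0 // mulr_gt0 // exprn_gt0.
rewrite muleC -lte_pdivrMl // -EFinM => /ereal_sup_gt[_ [S SK <-]].
rewrite lte_fin => h; exists S => //.
move: h; rewrite ltr_pdivrMl // -(ltr_pM2r Kd); congr (_ < _).
by field; rewrite gt_eqF.
Qed.

Lemma feasible_integral_le (phi : d.-tuple R -> R) :
  pack_ratio N x @[x --> +oo] --> 1%E -> feasible N phi ->
  (\int[leb d]_x (phi x)%:E <= v)%E.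
Proof.
move=> c1 /feasibleP[mphi phi0 bphi].
have voo := finite_ball c1.
have vfin : v \is a fin_num by rewrite ge0_fin_numE.
set V := fine v; have V0 : 0 < V by rewrite -lte_fin fineK ?leb_nball_gt0.
have key q : 0 < q < 1 -> (\int[leb d]_x (phi x)%:E <= (V / q)%:E)%E.
  move=> /andP[q0 q1].
  have -> : V / q = 1 / (q / V) by rewrite invf_div mul1r.
  have qV : 0 < q / V by rewrite divr_gt0.
  apply: (averaging mphi phi0 bphi ler01 qV) => K0.
  (* With this [t], [q * (1 + t) ^ d <= q + 2 ^ d * t <= 1 - (1 - q) / 2], and packings of ratio
     above the right side exist near the limit 1. *)
  pose t := Num.min 1 ((1 - q) / (2 * 2 ^+ d)).
  have p2 : 0 < 2 ^+ d :> R by rewrite exprn_gt0.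
  have t0 : 0 < t by rewrite lt_min ltr01 divr_gt0 ?subr_gt0 // mulr_gt0.
  have t1 : t <= 1 by rewrite ge_min lexx.
  have t2 : 2 ^+ d * t <= (1 - q) / 2.
    apply: (@le_trans _ _ (2 ^+ d * ((1 - q) / (2 * 2 ^+ d)))).
      by rewrite ler_pM2l // ge_min lexx orbT.
    by rewrite le_eqVlt; apply/orP; left; apply/eqP; field; rewrite gt_eqF.
  have : \forall K \near +oo, ((1 - (1 - q) / 2)%:E < pack_ratio N K)%E.
    have q1' : ((1 - (1 - q) / 2)%:E < 1%E :> \bar R)%E by rewrite lte_fin; lra.
    exact: (c1 _ (open_ereal_gt' q1')).
  move=> near1.
  have [K [KK rK]] : exists K, Num.max 1 (2 * K0) < K /\
      ((1 - (1 - q) / 2)%:E < pack_ratio N K)%E.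
    have big : \forall K \near +oo, Num.max 1 (2 * K0) < K by apply: nbhs_pinfty_gt; exact: num_real.
    exact: filter_ex (filterI big near1).
  have K1 : 1 < K by apply: le_lt_trans KK; rewrite le_max lexx.
  have K2 : 2 * K0 < K by apply: le_lt_trans KK; rewrite le_max lexx orbT.
  have Kpos : 0 < K by lra.
  have [S SK Sq] := packing_of_ratio Kpos voo rK.
  have l1 : 1 < 1 + t by lra.
  exists ((1 + t) / 2 * K); first by nra.
  exists [seq vscale ((1 + t) / 2) c | c <- S]; first exact: packing_spread.
  rewrite size_map; have td := @expr1D_le R d t; rewrite (ltW t0) t1 in td.
  have {}td := td isT; rewrite -/V in Sq.
  rewrite mulrAC ler_pdivrMr // !exprMn exprVn -(ler_pM2l p2).
  rewrite [leLHS](_ : _ = q * (1 + t) ^+ d * K ^+ d); last by field; rewrite gt_eqF.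
  rewrite [leRHS](_ : _ = (size S)%:R * (2 ^+ d * V)); last by ring.
  apply: le_trans (ltW Sq); rewrite ler_pM2r ?exprn_gt0 //.
  have : q * (1 + t) ^+ d <= q * (1 + 2 ^+ d * t) by rewrite ler_pM2l.
  have : q * (2 ^+ d * t) <= 2 ^+ d * t by rewrite ler_piMl ?mulr_ge0 // ltW.
  by lra.
rewrite -(fineK vfin) -/V; apply/lee_addgt0Pr => e e0.
have q01 : 0 < V / (V + e) < 1.
  by rewrite divr_gt0 ?addr_gt0 //= ltr_pdivrMr ?addr_gt0 // mul1r ltrDl.
apply: (le_trans (key _ q01)); rewrite -EFinD lee_fin invf_div mulrA.
by rewrite mulrAC divff ?gt_eqF // mul1r.
Unshelve. all: by end_near. Qed.

End feasibility.

(** * Feasible functions at large s *)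

Section concentrated.
Context {R : realType} {d : nat} {N : d.-tuple R -> R} (HN : is_norm N).

Notation v := (leb d (nball N (vzero R d) 2^-1)).
Hypothesis voo : (v < +oo)%E.
Notation V := (fine v).

Lemma fine_ballE : V%:E = v.
Proof. by rewrite fineK // ge0_fin_numE. Qed.

Lemma fine_ball_gt0 : 0 < V.
Proof. by rewrite -lte_fin fine_ballE leb_nball_gt0. Qed.

Lemma measurable_superlevel (phi : d.-tuple R -> R) a :
  measurable_fun setT phi -> measurable [set x | a < phi x].
Proof.
move=> mphi; have -> : [set x | a < phi x] = phi @^-1` `]a, +oo[%classic.
  by apply/seteqP; split => x /=; rewrite in_itv /= andbT.
by rewrite -[X in measurable X]setTI; exact: mphi.
Qed.

Lemma feasible_pair (phi : d.-tuple R -> R) x y : feasible N phi ->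
  1 < phi x + phi y -> N (vsub x y) <= 1.
Proof.
move=> /feasibleP[_ phi0 bphi]; rewrite ltNge; apply: contraR; rewrite -ltNge => xy.
have [xyE|xyE] := eqVneq x y.
  by move: xy; rewrite xyE (_ : vsub y y = vzero R d) ?(normv0 HN) ?ltNge ?ler01 //; vring.
have := bphi [:: x; y]; rewrite !big_cons big_nil addr0; apply; first by rewrite /= inE xyE.
by move=> a b /=; rewrite !inE => /orP[]/eqP -> /orP[]/eqP -> // _; rewrite (normv_subC HN).
Qed.

Lemma superlevel_le (phi : d.-tuple R -> R) a : feasible N phi -> 2^-1 <= a ->
  (leb d [set x | a < phi x]%R <= V%:E)%E.
Proof.
move=> fphi a2; have [mphi phi0 _] := (feasibleP phi).1 fphi.
have mA := measurable_superlevel a mphi.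
have : (leb d [set x | a < phi x]%R * leb d [set x | a < phi x]%R <= V%:E * V%:E)%E.
  rewrite fine_ballE; apply: leb_mul_le => // x y /= ax ay.
  by apply: (feasible_pair fphi); lra.
have V0 := fine_ball_gt0.
case: (leb d _) (measure_ge0 (leb d) [set x | a < phi x]%R) => [r| |] //=.
  by rewrite -!EFinM !lee_fin => r0 h; rewrite leNgt; apply/negP => rV; nra.
Qed.

Section inside.
Variables (phi : d.-tuple R -> R) (x0 : d.-tuple R).
Hypotheses (fphi : feasible N phi) (x0half : 2^-1 < phi x0).
Notation B := (closed_nball (N := N) x0 1).
Let K0 : R := 2 * 2 ^+ d.

(** The two volumes have product at most [V ^ 2], and are at most [2 ^ d * V] and [V]; the weight
    [K0 = 2 * 2 ^ d] makes the linear bound follow from these three. *)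
Lemma level_pair a : 0 < a < 2^-1 ->
  (leb d [set x | (0 < a < Num.min (phi x) 2^-1 * \1_B x)%R] +
   K0%:E * leb d [set x | (1 - phi x < a < 2^-1)%R] <= ((1 + K0) * V)%:E)%E.
Proof.
move=> /andP[a0 a2]; have [mphi phi0 _] := (feasibleP phi).1 fphi.
have mB : measurable B by exact: measurable_closed_nball.
have mmin : measurable_fun setT (fun x => Num.min (phi x) 2^-1 * \1_B x).
  apply: measurable_funM; last exact: measurable_indic.
  exact: measurable_minr.
set E1 := [set x | _]; set E2 := [set x | _].
have mE1 : measurable E1 by exact: (measurable_level (l := fun=> 0)).
have mE2 : measurable E2.
  by apply: (measurable_level (u := fun=> 2^-1)) => //; exact: measurable_funB.
have E1B x : E1 x -> B x /\ a < phi x.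
  rewrite /E1 /= a0 /= indicE; case: (boolP (x \in B)) => xB.
    by rewrite mulr1 lt_min => /andP[ax _]; split => //; exact/set_mem.
  by rewrite mulr0 ltNge ltW.
have E2le : (leb d E2 <= V%:E)%E.
  apply: le_trans (superlevel_le (a := 1 - a) fphi _); last by lra.
  apply: le_measureS => //; first exact: measurable_superlevel.
  by move=> x; rewrite /E2 /= => /andP[h _]; lra.
have E1le : (leb d E1 <= (2 ^+ d * V)%:E)%E.
  apply: (@le_trans _ _ (leb d B)).
    by apply: le_measureS => // x /E1B[].
  have := leb_closed_nball_le HN x0 (@ltr01 R) voo.
  by rewrite mulr1 EFinM fine_ballE.
have E12 : (leb d E1 * leb d E2 <= V%:E * V%:E)%E.
  rewrite fine_ballE; apply: leb_mul_le => // x y /E1B[_ ax].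
  by rewrite /E2 /= => /andP[ay _]; apply: (feasible_pair fphi); lra.
have V0 := fine_ball_gt0.
have p2 : 1 <= 2 ^+ d :> R by rewrite exprn_ege1 // ler1n.
have E10 : (0 <= leb d E1)%E by exact: measure_ge0.
have E20 : (0 <= leb d E2)%E by exact: measure_ge0.
move: E12 E1le E2le E10 E20.
case: (leb d E1) => [e1| |] //; case: (leb d E2) => [e2| |] //.
rewrite -!EFinM -EFinD !lee_fin /K0; move: (2 ^+ d) p2 => P P1 e12 e1P e2V e10 e20.
(* If [2 * e2 < V], the bound [e1 <= P * V] suffices. Otherwise [(2 * e2 - V) * (V - e2) >= 0] puts
   the hyperbola [V ^ 2 / e2] below the line [V + 2 * (V - e2)]. *)
have [h|h] := leP V (2 * e2); last by nra.
have e20' : 0 < e2 by lra.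
have q : 0 <= (2 * e2 - V) * (V - e2) by rewrite mulr_ge0 // subr_ge0.
have : e1 * e2 <= (V + 2 * (V - e2)) * e2 by lra.
rewrite ler_pM2r // => h1.
have : 0 <= (P - 1) * (V - e2) by rewrite mulr_ge0 // subr_ge0.
by lra.
Qed.

(** Integrate [level_pair] over [a] in [(0, 1/2)]: the lower levels rebuild the minimum with 1/2 on
    [B], the reflected ones the excess over 1/2. All other levels are empty. *)
Lemma inside_bound :
  (\int[leb d]_x (Num.min (phi x) 2^-1 * \1_B x)%:E +
   K0%:E * \int[leb d]_x (Num.max 0 (phi x - 2^-1))%:E <= ((1 + K0) * V / 2)%:E)%E.
Proof.
have [mphi phi0 _] := (feasibleP phi).1 fphi.
have phi1 x : phi x <= 1 by case/andP: (feasible_01 fphi x).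
have mB : measurable B by exact: measurable_closed_nball.
have mmin : measurable_fun setT (fun x => Num.min (phi x) 2^-1 * \1_B x).
  apply: measurable_funM; last exact: measurable_indic.
  exact: measurable_minr.
have m1 : measurable_fun setT (fun x => 1 - phi x) by exact: measurable_funB.
have K00 : 0 <= K0 by rewrite mulr_ge0 // exprn_ge0.
have half0 : 0 <= 2^-1 :> R by rewrite invr_ge0.
have min0 x : 0 <= Num.min (phi x) 2^-1 * \1_B x by rewrite mulr_ge0 // le_min phi0.
have -> : (\int[leb d]_x (Num.min (phi x) 2^-1 * \1_B x)%:E =
    \int[@lebesgue_measure R]_a leb d [set x | (0 < a < Num.min (phi x) 2^-1 * \1_B x)%R])%E.
  rewrite -(region_tonelli (leb d) (l := fun=> 0)) //.
  by apply: eq_integral => x _; rewrite subr0 max_r.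
have -> : (\int[leb d]_x (Num.max 0 (phi x - 2^-1))%:E =
    \int[@lebesgue_measure R]_a leb d [set x | (1 - phi x < a < 2^-1)%R])%E.
  rewrite -(region_tonelli (leb d) (u := fun=> 2^-1)) //.
  by apply: eq_integral => x _; congr (Num.max 0 _)%:E; lra.
have ml1 := measurable_fun_level (leb d) (l := fun=> 0) (measurable_cst _) mmin.
have ml2 := measurable_fun_level (leb d) (u := fun=> 2^-1) m1 (measurable_cst _).
rewrite -ge0_integralZl_EFin // -ge0_integralD //; last 2 first.
- by move=> a _; rewrite mule_ge0.
- by apply: measurable_funeM.
have -> : ((1 + K0) * V / 2)%:E = (\int[@lebesgue_measure R]_a
    (((1 + K0) * V)%:E * (\1_`]0%R, (2^-1 : R)[%classic a)%:E))%E.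
  rewrite ge0_integralZl_EFin //.
  - rewrite integral_indicT //= lebesgue_measure_itv /= lte_fin invr_gt0 ltr0n.
    by rewrite oppr0 adde0 -EFinM.
  - exact/measurable_EFinP/measurable_indic.
  - by rewrite mulr_ge0 ?addr_ge0 // ltW // fine_ball_gt0.
apply: ge0_le_integral => //.
- by move=> a _; rewrite adde_ge0 // mule_ge0.
- by apply: emeasurable_funD => //; apply: measurable_funeM.
- by apply: measurable_funeM; exact/measurable_EFinP/measurable_indic.
move=> a _; rewrite indicE; case: (boolP (a \in _)) => a01.
  by move/set_mem: a01; rewrite /= in_itv /= mule1; exact: level_pair.
rewrite mule0; have na : ~ (0 < a < 2^-1).
  by move=> h; move/negP: a01; apply; rewrite inE /= in_itv.
have E1 : [set x | (0 < a < Num.min (phi x) 2^-1 * \1_B x)%R] = set0.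
  apply/seteqP; split => x //= /andP[h1 h2]; apply: na; rewrite h1 /=.
  apply: (lt_le_trans h2); rewrite indicE; case: (_ \in _); last by rewrite mulr0.
  by rewrite mulr1 ge_min lexx orbT.
have E2 : [set x | (1 - phi x < a < 2^-1)%R] = set0.
  apply/seteqP; split => x //= /andP[h1 h2]; apply: na; rewrite h2 andbT.
  by have := phi1 x; lra.
by rewrite E1 E2 !measure0 mule0 adde0.
Qed.

(** A well-spread family outside [B] stays well-spread when [x0] is added, and [phi x0] then uses up
    part of the bound 1. *)
Lemma outside_spread_bounded :
  spread_bounded N (fun x => phi x * \1_(~` B) x) (1 - phi x0).
Proof.
have [mphi phi0 bphi] := (feasibleP phi).1 fphi.
move=> s us ws.
rewrite (bigID (mem (~` B))) /= [X in _ + X]big1 ?addr0; last first.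
  by move=> x xB; rewrite indicE (negbTE xB) mulr0.
rewrite lerBrDl -[in leLHS]big_filter.
apply: (@le_trans _ _ (\sum_(x <- x0 :: [seq x <- s | x \in ~` B]) phi x)).
  rewrite big_cons lerD2l; apply: ler_sum => x _.
  by rewrite ler_piMr // indicE lern1 leq_b1.
have far x : x \in [seq x <- s | x \in ~` B] -> 1 < N (vsub x0 x).
  by rewrite mem_filter => /andP[/set_mem /= h _]; rewrite ltNge; apply/negP.
apply: bphi.
  rewrite /= filter_uniq // andbT; apply/negP => /far.
  by rewrite (_ : vsub x0 x0 = vzero R d) ?(normv0 HN) ?ltNge ?ler01 //; vring.
move=> a b /=; rewrite !inE => /orP[/eqP ->|sa] /orP[/eqP ->|sb] // ab.
- exact: far.
- by rewrite (normv_subC HN); exact: far.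
- by move: sa sb; rewrite !mem_filter => /andP[_ sa] /andP[_ sb]; exact: ws.
Qed.

End inside.

(** The indicator of the half ball gives equality for every [K], so the right side has no room; [K]
    has to be large enough to penalise functions whose supremum is below 1. *)
Lemma min_half_bound : exists2 K, 1 < K & forall phi, feasible N phi ->
  rint (fun x => Num.min (phi x) 2^-1) + K * rint (fun x => Num.max 0 (phi x - 2^-1)) <=
  (1 + K) * V / 2.
Proof.
have [C C0 HC] := feasible_integral_bound HN voo.
have V0 := fine_ball_gt0.
have p2 : 1 <= 2 ^+ d :> R by rewrite exprn_ege1 // ler1n.
(* [K0] serves the part inside the ball. With [M] the supremum of [phi], [K2] adds at most
   [(2 * M - 1) * C] on the left and exactly [C] on the right; the gain [2 * (1 - M) * C] covers the
   mass outside. *)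
pose K0 : R := 2 * 2 ^+ d; pose K2 := 2 * C / V.
have K20 : 0 < K2 by rewrite divr_gt0 // mulr_gt0.
have K2V : K2 * V = 2 * C by rewrite /K2 divfK // gt_eqF.
have K00 : 0 < K0 by rewrite /K0; lra.
exists (K0 + K2) => [|phi fphi]; first by rewrite /K0; lra.
have [mphi phi0 bphi] := (feasibleP phi).1 fphi.
have phi01 := feasible_01 fphi.
have phioo : (\int[leb d]_x (phi x)%:E < +oo)%E.
  by apply: le_lt_trans (HC _ _ mphi phi0 bphi ler01) _; rewrite ltry.
have rintC psi : dominated phi psi -> (forall m, spread_bounded N psi m -> 0 <= m -> rint psi <= m * C).
  by move=> dpsi m bm m0; rewrite -lee_fin (rintE mphi phi01 phioo dpsi); case: dpsi => *; exact: HC.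
have half0 : 0 <= 2^-1 :> R by rewrite invr_ge0.
have dmin : dominated phi (fun x => Num.min (phi x) 2^-1).
  split; first exact: measurable_minr.
    by move=> x; rewrite le_min phi0.
  by exists 1 => x; rewrite mul1r ge_min lexx.
have dmax : dominated phi (fun x => Num.max 0 (phi x - 2^-1)).
  split; first by apply: measurable_maxr => //; exact: measurable_funB.
    by move=> x; rewrite le_max lexx.
  by exists 1 => x; rewrite mul1r ge_max phi0 lerBlDr lerDl.
have dphi : dominated phi phi by exact: dominated_phi.
(* If [phi] never exceeds 1/2, the term [K2 * V / 2 = C] alone bounds its integral. *)
have [[xA xAhalf]|nA] := pselect (exists x, 2^-1 < phi x); last first.
  have -> : rint (fun x => Num.max 0 (phi x - 2^-1)) = 0.
    rewrite /rint integral0_eq // => x _; rewrite max_l // subr_le0 leNgt.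
    by apply/negP => h; apply: nA; exists x.
  have : rint (fun x => Num.min (phi x) 2^-1) <= rint phi.
    by apply: (ler_rint mphi phi01 phioo dmin dphi) => x; rewrite ge_min lexx.
  have := rintC _ dphi 1 bphi ler01; rewrite mulr0 addr0.
  have : 0 <= K0 * V by rewrite mulr_ge0 // ltW.
  by lra.
have hs : has_sup (range phi).
  by split; [exists (phi xA), xA|exists 1 => _ [x _ <-]; case/andP: (phi01 x)].
set M := sup (range phi).
have phiM x : phi x <= M by apply: sup_upper_bound => //; exists x.
have M1 : M <= 1 by apply: ge_sup => [|_ [x _ <-]]; [case: hs|case/andP: (phi01 x)].
have maxle : rint (fun x => Num.max 0 (phi x - 2^-1)) <= (M - 2^-1) * V.
  have M2 : 0 <= M - 2^-1 by rewrite subr_ge0 ltW // (lt_le_trans xAhalf).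
  have mA := measurable_superlevel 2^-1 mphi.
  rewrite -lee_fin (rintE mphi phi01 phioo dmax) EFinM.
  apply: (@le_trans _ _ ((M - 2^-1)%:E * leb d [set x | (2^-1 < phi x)%R])%E); last first.
    by apply: lee_wpmul2l; [rewrite lee_fin|exact: superlevel_le].
  rewrite -integral_indicT // -ge0_integralZl_EFin //; last exact/measurable_EFinP/measurable_indic.
  apply: ge0_le_integral => //.
  - by move=> x _; rewrite lee_fin; case: dmax.
  - by apply/measurable_EFinP; case: dmax.
  - by apply: measurable_funeM; exact/measurable_EFinP/measurable_indic.
  move=> x _; rewrite -EFinM lee_fin indicE; case: (boolP (x \in _)) => xA'.
    rewrite mulr1 ge_max M2 lerD2r; exact: phiM.
  rewrite mulr0 max_l // subr_le0 leNgt; apply/negP => h.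
  by move/negP: xA'; apply; rewrite inE.
apply/ler_addgt0Pr => e e0.
(* The supremum need not be attained: [x0] comes within [eta] of it, at a cost [eta * C <= e], and
   the first entry of the minimum keeps [phi x0] above 1/2. *)
pose eta := Num.min (M - 2^-1) (e / C).
have eta0 : 0 < eta by rewrite lt_min divr_gt0 // andbT subr_gt0 (lt_le_trans xAhalf).
have etaC : eta * C <= e by rewrite -ler_pdivlMr // ge_min lexx orbT.
have [_ [x0 _ <-] x0M] := sup_adherent eta0 hs; rewrite -/M in x0M.
have x0half : 2^-1 < phi x0.
  have etaM : eta <= M - 2^-1 by rewrite ge_min lexx.
  apply: le_lt_trans x0M.
  by rewrite lerBrDr -lerBrDl.
set B := closed_nball (N := N) x0 1.
have mB : measurable B by exact: measurable_closed_nball.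
have dB : dominated phi (fun x => Num.min (phi x) 2^-1 * \1_B x).
  split; first by apply: measurable_funM; [exact: measurable_minr|exact: measurable_indic].
    by move=> x; rewrite mulr_ge0 // le_min phi0.
  exists 1 => x; rewrite mul1r; apply: (@le_trans _ _ (Num.min (phi x) 2^-1)).
    by apply: ler_piMr; [rewrite le_min phi0|rewrite indicE lern1 leq_b1].
  by rewrite ge_min lexx.
have dC : dominated phi (fun x => phi x * \1_(~` B) x).
  split; first by apply: measurable_funM => //; apply: measurable_indic; exact: measurableC.
    by move=> x; rewrite mulr_ge0.
  by exists 1 => x; rewrite mul1r ler_piMr // indicE lern1 leq_b1.
have inB : rint (fun x => Num.min (phi x) 2^-1 * \1_B x) +
    K0 * rint (fun x => Num.max 0 (phi x - 2^-1)) <= (1 + K0) * V / 2.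
  rewrite -lee_fin EFinD EFinM (rintE mphi phi01 phioo dmax) (rintE mphi phi01 phioo dB).
  exact: inside_bound.
have outB : rint (fun x => phi x * \1_(~` B) x) <= (1 - phi x0) * C.
  apply: rintC => //; first exact: outside_spread_bounded.
  by rewrite subr_ge0; case/andP: (phi01 x0).
have split_min : rint (fun x => Num.min (phi x) 2^-1) <=
    rint (fun x => Num.min (phi x) 2^-1 * \1_B x) + rint (fun x => phi x * \1_(~` B) x).
  rewrite -(rintD mphi phi01 phioo dB dC).
  apply: (ler_rint mphi phi01 phioo dmin (dominatedD dB dC)) => x.
  rewrite !indicE in_setC; case: (x \in B) => /=.
    by rewrite mulr1 mulr0 addr0.
  by rewrite mulr0 mulr1 add0r ge_min lexx.
have h1 : (1 - phi x0) * C <= (1 - M) * C + eta * C.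
  by rewrite -mulrDl ler_pM2r //; move: (ltW x0M); move: (M) (phi x0) (eta) => a b c; lra.
have h2 : K2 * rint (fun x => Num.max 0 (phi x - 2^-1)) <= K2 * ((M - 2^-1) * V) by rewrite ler_pM2l.
have h3 : K2 * ((M - 2^-1) * V) = (M - 2^-1) * (2 * C) by rewrite -K2V; ring.
have h4 : M * C <= C by rewrite ler_piMl // ltW.
rewrite mulrDl.
have -> : (1 + (K0 + K2)) * V / 2 = (1 + K0) * V / 2 + C.
  by rewrite addrA [(_ + K2) * V]mulrDl K2V mulrDl; congr (_ + _); field.
by lra.
Qed.

(* At [s = 2 ln K] the two chords of [expR (s * _)] over [0, 1/2] and [1/2, 1]
   have slopes in the ratio [1 : K] of [min_half_bound]. *)
Lemma Phi_le_half_ball : exists2 s, 0 < s & forall phi, feasible N phi ->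
  Phi phi s <= V * (expR s - 1).
Proof.
have [K K1 HK] := min_half_bound.
have K0 : 0 < K by lra.
exists (2 * ln K) => [|phi fphi]; first by rewrite mulr_gt0 // ln_gt0.
have [C C0 HC] := feasible_integral_bound HN voo.
have [mphi phi0 bphi] := (feasibleP phi).1 fphi.
have phi01 := feasible_01 fphi.
have phioo : (\int[leb d]_x (phi x)%:E < +oo)%E.
  by apply: le_lt_trans (HC _ _ mphi phi0 bphi ler01) _; rewrite ltry.
have half0 : 0 <= 2^-1 :> R by rewrite invr_ge0.
have dmin : dominated phi (fun x => Num.min (phi x) 2^-1).
  split; first exact: measurable_minr.
    by move=> x; rewrite le_min phi0.
  by exists 1 => x; rewrite mul1r ge_min lexx.
have dmax : dominated phi (fun x => Num.max 0 (phi x - 2^-1)).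
  split; first by apply: measurable_maxr => //; exact: measurable_funB.
    by move=> x; rewrite le_max lexx.
  by exists 1 => x; rewrite mul1r ge_max phi0 lerBlDr lerDl.
have s0 : 0 <= 2 * ln K by rewrite mulr_ge0 // ln_ge0 // ltW.
have K10 : 0 <= 2 * (K - 1) by rewrite mulr_ge0 // subr_ge0 ltW.
have dK := dominatedZ (ltW K0) dmax.
have dS := dominatedD dmin dK.
have -> : V * (expR (2 * ln K) - 1) = 2 * (K - 1) * ((1 + K) * V / 2).
  by rewrite mulr_natl mulr2n expRD lnK ?posrE //; field.
apply: (@le_trans _ _ (2 * (K - 1) * (rint (fun x => Num.min (phi x) 2^-1) +
    K * rint (fun x => Num.max 0 (phi x - 2^-1))))); last by apply: ler_wpM2l => //; exact: HK.
rewrite -(rintZ mphi phi01 phioo (ltW K0) dmax) -(rintD mphi phi01 phioo dmin dK).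
rewrite -(rintZ mphi phi01 phioo K10 dS).
apply: (ler_rint mphi phi01 phioo (dominated_expR1 mphi phi01 s0) (dominatedZ K10 dS)) => x.
exact: half_chord.
Qed.

End concentrated.

(** * Comparison of f_chi with f_omega *)

Section comparison.
Context {R : realType} {d : nat} {N : d.-tuple R -> R} (HN : is_norm N).

Notation v := (leb d (nball N (vzero R d) 2^-1)).
Hypothesis voo : (v < +oo)%E.
Notation V := (fine v).

Let V0 : 0 < V := fine_ball_gt0 HN voo.

Lemma feasible_lty (phi : d.-tuple R -> R) : feasible N phi ->
  (\int[leb d]_x (phi x)%:E < +oo)%E.
Proof.
move=> /feasibleP[mphi phi0 bphi]; have [C C0 HC] := feasible_integral_bound HN voo.
by apply: le_lt_trans (HC _ _ mphi phi0 bphi ler01) _; rewrite ltry.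
Qed.

Lemma feasible_xi (phi : d.-tuple R -> R) : feasible N phi ->
  rint phi = 0 /\ (forall t, xi phi t = 0%E) \/
  (forall t, 0 < t -> exists X s, [/\ xi phi t = X%:E, 0 < s,
     s * X = t^-1 + Phi phi s, (forall r, 0 < r -> r * X <= t^-1 + Phi phi r) & rint phi <= X]).
Proof.
move=> fphi; have [mphi phi0 bphi] := (feasibleP phi).1 fphi.
have phi01 := feasible_01 fphi; have phioo := feasible_lty fphi.
have dphi : dominated phi phi by exact: dominated_phi.
have [J0|J0] := eqVneq (rint phi) 0; [left; split=> // t|right].
  by rewrite /xi integE // -(rintE mphi phi01 phioo dphi) J0 eqxx.
apply: xi_spec => //; rewrite lt_neqAle eq_sym J0 /=.
exact: (rint_ge0 mphi phi01 phioo).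
Qed.

Lemma feasible_Phi_ge0 (phi : d.-tuple R -> R) s : feasible N phi -> 0 <= s -> 0 <= Phi phi s.
Proof.
move=> fphi s0; have [mphi phi0 bphi] := (feasibleP phi).1 fphi.
have phi01 := feasible_01 fphi; have phioo := feasible_lty fphi.
by apply: (rint_ge0 mphi phi01 phioo); exact: dominated_expR1.
Qed.

Lemma xi_ge0 (phi : d.-tuple R -> R) t : feasible N phi -> 0 < t -> (0 <= xi phi t)%E.
Proof.
move=> fphi t0; have [[_ ->]//|/(_ t t0)[X [s [-> s0 sX _ _]]]] := feasible_xi fphi.
rewrite lee_fin -(pmulr_rge0 _ s0) sX addr_ge0 ?invr_ge0 ?(ltW t0) //.
by apply: feasible_Phi_ge0 => //; exact: ltW.
Qed.

Lemma xi_le (phi : d.-tuple R -> R) t r : feasible N phi -> 0 < t -> 0 < r ->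
  (xi phi t <= ((t^-1 + Phi phi r) / r)%:E)%E.
Proof.
move=> fphi t0 r0; have [[_ ->]|/(_ t t0)[X [s [-> s0 sX h _]]]] := feasible_xi fphi.
  rewrite lee_fin divr_ge0 ?(ltW r0) // addr_ge0 ?invr_ge0 ?(ltW t0) //.
  by apply: feasible_Phi_ge0 => //; exact: ltW.
by rewrite lee_fin ler_pdivlMr // mulrC h.
Qed.

Lemma f_chi_le t r B : 0 < t -> 0 < r -> (forall phi, feasible N phi -> Phi phi r <= B) ->
  (f_chi N t <= ((t^-1 + B) / r)%:E)%E.
Proof.
move=> t0 r0 PB; apply: ge_ereal_sup => _ [phi fphi <-].
apply: le_trans (xi_le fphi t0 r0) _.
by rewrite lee_fin ler_pM2r ?invr_gt0 // lerD2l PB.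
Qed.

Lemma xi_le_f_chi (phi : d.-tuple R -> R) t : feasible N phi -> (xi phi t <= f_chi N t)%E.
Proof. by move=> fphi; apply: ereal_sup_ubound; exists phi. Qed.

Lemma f_omega_le_f_chi t : (f_omega N t <= f_chi N t)%E.
Proof. exact/xi_le_f_chi/feasible_half_ball. Qed.

Lemma Phi_half_ball s : 0 <= s ->
  Phi (\1_(nball N (vzero R d) 2^-1) : _ -> R) s = V * (expR s - 1).
Proof.
move=> s0; have mB := measurable_nball HN (vzero R d) 2^-1.
rewrite mulrC /Phi; set B := nball _ _ _ in mB *.
have -> : (fun x => expR (s * \1_B x) - 1) = (fun x => (expR s - 1) * \1_B x).
  apply/funext => x; rewrite indicE; case: (x \in B); rewrite ?mulr1 //.
  by rewrite !mulr0 expR0 subrr.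
rewrite /rint; under eq_integral do rewrite EFinM.
rewrite ge0_integralZl_EFin //.
- by rewrite integral_indicT // fineM // ge0_fin_numE.
- exact/measurable_EFinP/measurable_indic.
- by rewrite subr_ge0; have := expR_ge1Dx s; lra.
Qed.

(* [W * expR p] is the value of [xi] for the indicator of a set of volume [W]. *)
Lemma young_indicator (W t p r : R) : 0 <= W -> W * Hf (expR p) = t^-1 ->
  r * (W * expR p) <= t^-1 + W * (expR r - 1).
Proof. by move=> W0 <-; have := ler_wpM2l W0 (young_Hf r p); lra. Qed.

Lemma indicator_value (W t p : R) : W * Hf (expR p) = t^-1 ->
  p * (W * expR p) = t^-1 + W * (expR p - 1).
Proof. by move=> <-; rewrite HfE; ring. Qed.

(** Each of the two values is tested at the minimiser of the other. *)
Lemma f_omegaE t q : 0 < t -> 0 < q -> V * Hf (expR q) = t^-1 ->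
  f_omega N t = (V * expR q)%:E.
Proof.
move=> t0 q0 qE; have fB := feasible_half_ball HN.
have := feasible_xi fB; case=> [[+ _]|/(_ t t0)].
  rewrite /rint integral_indicT; last exact: measurable_nball.
  by move=> e; move: V0; rewrite e ltxx.
move=> [X [s [XE s0 sX h _]]]; rewrite /f_omega XE; congr EFin.
apply/eqP; rewrite eq_le; apply/andP; split.
  rewrite -(ler_pM2l q0) (indicator_value qE) (le_trans (h q q0)) //.
  by rewrite Phi_half_ball // ltW.
rewrite -(ler_pM2l s0) sX Phi_half_ball; last exact: ltW.
exact: young_indicator (ltW V0) qE.
Qed.

Lemma f_omega_root t : 0 < t -> exists q, [/\ 0 < q, V * Hf (expR q) = t^-1 &
  f_omega N t = (V * expR q)%:E].
Proof.
move=> t0; have [|q q0 qE] := @Hf_root R (t^-1 / V); first by rewrite divr_gt0 // invr_gt0.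
exists q; have E : V * Hf (expR q) = t^-1 by rewrite qE mulrC divfK // gt_eqF.
by split => //; exact: f_omegaE.
Qed.

Lemma f_omega_gt0 t : 0 < t -> 0 < fine (f_omega N t).
Proof. by move=> /f_omega_root[q [q0 _ ->]] /=; rewrite mulr_gt0 // expR_gt0. Qed.

Lemma f_omega_fin t : 0 < t -> f_omega N t \is a fin_num.
Proof. by move=> /f_omega_root[q [_ _ ->]]. Qed.

Lemma f_chi_fin t : 0 < t -> f_chi N t \is a fin_num.
Proof.
move=> t0; have [C C0 HC] := feasible_integral_bound HN voo.
rewrite fin_numE; apply/andP; split.
  apply/eqP => e; have := f_omega_le_f_chi t; rewrite e leeNy_eq => /eqP h.
  by have := f_omega_fin t0; rewrite h.
have PB phi : feasible N phi -> Phi phi 1 <= C * (expR 1 - 1).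
  move=> fphi; have [mphi phi0 bphi] := (feasibleP phi).1 fphi.
  have phi01 := feasible_01 fphi; have phioo := feasible_lty fphi.
  apply: (le_trans (Phi_chord mphi phi01 phioo ler01)).
  apply: ler_wpM2r; first by have := @expR_ge1Dx R 1; lra.
  rewrite -lee_fin (rintE mphi phi01 phioo); last exact: dominated_phi.
  by have := HC _ _ mphi phi0 bphi ler01; rewrite mul1r.
have := f_chi_le t0 ltr01 PB.
by apply: contraTneq => ->; rewrite leye_eq.
Qed.

(** Here [s] is the minimiser for the half ball at this [t], so comparing [Phi] at this one exponent
    is enough. *)
Lemma f_chi_eq_f_omega t s : 0 < t -> 0 < s -> V * Hf (expR s) = t^-1 ->
  (forall phi, feasible N phi -> Phi phi s <= V * (expR s - 1)) ->
  f_chi N t = f_omega N t.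
Proof.
move=> t0 s0 sE PV; apply/eqP; rewrite eq_le f_omega_le_f_chi andbT.
rewrite (f_omegaE t0 s0 sE); apply: le_trans (f_chi_le t0 s0 PV) _.
by rewrite lee_fin ler_pdivrMr // -(indicator_value sE) mulrC.
Qed.

Lemma xi_crossing (phi : d.-tuple R -> R) (t1 t2 W p1 p2 : R) : feasible N phi ->
  0 < t1 < t2 -> 0 < W -> 0 < p1 ->
  W * Hf (expR p1) = t1^-1 -> W * Hf (expR p2) = t2^-1 ->
  ((W * expR p1)%:E <= xi phi t1)%E -> ((W * expR p2)%:E <= xi phi t2)%E.
Proof.
move=> fphi /andP[t10 t12] W0 p10 p1E p2E; have t20 := lt_trans t10 t12.
have [mphi phi0 bphi] := (feasibleP phi).1 fphi.
have phi01 := feasible_01 fphi; have phioo := feasible_lty fphi.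
have [[_ ->]|h] := feasible_xi fphi.
  by rewrite lee_fin leNgt mulr_gt0 // expR_gt0.
have [X1 [s1 [-> _ _ h1 _]]] := h t1 t10; have [X2 [s2 [-> s20 s2X2 _ _]]] := h t2 t20.
rewrite !lee_fin => WX1.
have t21 : t2^-1 <= t1^-1 by rewrite lef_pV2 ?posrE // ltW.
have P1 : W * (expR p1 - 1) <= Phi phi p1.
  have := h1 p1 p10; have := indicator_value p1E.
  have : p1 * (W * expR p1) <= p1 * X1 by rewrite ler_pM2l.
  by lra.
rewrite -(ler_pM2l s20).
(* For [s2 <= p1], monotonicity of [Phi phi s / (expR s - 1)] carries the comparison [P1] from [p1]
   down to the minimiser [s2]. *)
have [s2p1|p1s2] := leP s2 p1.
  rewrite s2X2; apply: le_trans (young_indicator s2 (ltW W0) p2E) _.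
  rewrite lerD2l; have e1 : 0 < expR p1 - 1 by rewrite subr_gt0 expR_gt1.
  have e2 : 0 < expR s2 - 1 by rewrite subr_gt0 expR_gt1.
  have := Phi_ratio mphi phi01 phioo (s := s2) (t := p1); rewrite s20 s2p1 => /(_ isT) h3.
  rewrite -(ler_pM2r e1); apply: le_trans h3.
  by rewrite mulrAC ler_pM2r.
(* For [p1 < s2]: from [t1] to [t2] the value of [phi] drops by at most [(t1^-1 - t2^-1) / s2], and
   that of the indicator by at least [(t1^-1 - t2^-1) / p1], which is no smaller. *)
have h2 := h1 s2 s20.
have h3 : s2 * (W * expR p1) <= s2 * X1 by rewrite ler_pM2l.
have h4 := young_indicator p1 (ltW W0) p2E.
have h5 := indicator_value p1E.
have h6 : p1 * (s2 * (W * expR p2)) <= p1 * (s2 * X2).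
  have h7 : s2 * (p1 * (W * expR p2)) <= s2 * (t2^-1 + W * (expR p1 - 1)) by rewrite ler_pM2l.
  have h8 : p1 * (s2 * (W * expR p1)) <= p1 * (t1^-1 + Phi phi s2).
    by rewrite ler_pM2l // (le_trans h3).
  have h9 : p1 * (t1^-1 - t2^-1) <= s2 * (t1^-1 - t2^-1).
    by rewrite ler_wpM2r ?subr_ge0 // ltW.
  have h10 : s2 * (p1 * (W * expR p1)) = s2 * (t1^-1 + W * (expR p1 - 1)) by rewrite h5.
  by rewrite s2X2; lra.
by rewrite ler_pM2l in h6.
Qed.

Lemma ratio_increasing (t1 t2 : R) : 0 < t1 < t2 -> (f_omega N t1 < f_chi N t1)%E ->
  fine (f_chi N t1) / fine (f_omega N t1) < fine (f_chi N t2) / fine (f_omega N t2).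
Proof.
move=> /andP[t10 t12]; have t20 := lt_trans t10 t12.
have [q1 [q10 q1E ->]] := f_omega_root t10; have [q2 [q20 q2E ->]] := f_omega_root t20.
rewrite -(fineK (f_chi_fin t10)) lte_fin /=; set F1 := fine (f_chi N t1).
set F2 := fine (f_chi N t2) => VF1.
have F10 : 0 < F1 by apply: le_lt_trans VF1; rewrite mulr_ge0 ?(ltW V0) ?expR_ge0.
have F20 : 0 < F2.
  apply: lt_le_trans (f_omega_gt0 t20) _; apply: fine_le; [exact: f_omega_fin|exact: f_chi_fin|].
  exact: f_omega_le_f_chi.
have t1i : 0 < t1^-1 by rewrite invr_gt0.
have t2i : 0 < t2^-1 by rewrite invr_gt0.
have t21 : t2^-1 < t1^-1 by rewrite ltf_pV2 ?posrE.
(* A value [F = W * expR p] with [W * Hf (expR p) = t^-1] satisfies [F * kf p = t^-1]. Solving for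
   [p] first gives the volume [W] whose curve passes through [F1] at [t1]. *)
have [|p1 p10 p1k] := @kf_root R (t1^-1 / F1); first by rewrite divr_gt0.
have H1 := Hf_gt0 p10.
pose W := t1^-1 / Hf (expR p1).
have W0 : 0 < W by rewrite divr_gt0.
have p1E : W * Hf (expR p1) = t1^-1 by rewrite divfK // gt_eqF.
have F1E : F1 = W * expR p1.
  rewrite /W Hf_kf p1k; field.
  by rewrite !gt_eqF ?expR_gt0.
have root (U t : R) : 0 < U -> 0 < t -> exists2 p, 0 < p & U * Hf (expR p) = t^-1.
  move=> U0 t0; have [|p p0 pE] := @Hf_root R (t^-1 / U); first by rewrite divr_gt0 // invr_gt0.
  by exists p => //; rewrite pE mulrC divfK // gt_eqF.
have Hf_mono (x y : R) : 0 < x -> 0 < y -> Hf (expR x) < Hf (expR y) -> x < y.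
  move=> x0 y0; apply: contraLR; rewrite -!leNgt => yx; apply: Hf_nondecreasing.
  by rewrite ltW.
have kf_mono (x y : R) : 0 < x -> 0 < y -> kf x < kf y -> x < y.
  move=> x0 y0; apply: contraLR; rewrite -!leNgt le_eqVlt => /orP[/eqP ->//|yx].
  by apply: ltW; apply: kf_lt; rewrite ltW.
have value_kf (U p t : R) : 0 < U -> 0 < p -> U * Hf (expR p) = t^-1 -> U * expR p * kf p = t^-1.
  by move=> U0 p0; rewrite Hf_kf mulrA.
have [p2 p20 p2E] := root W t2 W0 t20.
(* The curve of a smaller volume is strictly below [F1] at [t1], so some feasible [phi] lies above
   it there and, by the crossing lemma, still does at [t2]. *)
have key (U : R) : 0 < U < W -> U * expR p2 <= F2.
  move=> /andP[U0 UW]; have [p1' p1'0 p1'E] := root U t1 U0 t10.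
  have [p2' p2'0 p2'E] := root U t2 U0 t20.
  have H2 := Hf_gt0 p20.
  have pp1 : p1 < p1'.
    apply: Hf_mono => //; rewrite -(ltr_pM2l W0) p1E -p1'E ltr_pM2r //.
    exact: Hf_gt0.
  have pp2 : p2 < p2'.
    apply: Hf_mono => //; rewrite -(ltr_pM2l W0) p2E -p2'E ltr_pM2r //.
    exact: Hf_gt0.
  have kk : kf p1 < kf p1' by apply: kf_lt; rewrite ltW.
  have UF1 : U * expR p1' < F1.
    rewrite -(ltr_pM2r (kf_gt0 p1'0)) (value_kf _ _ _ U0 p1'0 p1'E).
    by rewrite -(value_kf _ _ _ W0 p10 p1E) -F1E ltr_pM2l.
  have : ((U * expR p1')%:E < f_chi N t1)%E by rewrite -(fineK (f_chi_fin t10)) lte_fin.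
  move=> /ereal_sup_gt[_ [phi fphi <-]] /ltW UX.
  have := xi_crossing fphi _ U0 p1'0 p1'E p2'E UX; rewrite t10 t12 => /(_ isT) UX2.
  apply: (@le_trans _ _ (U * expR p2')); first by rewrite ler_pM2l // ler_expR ltW.
  rewrite -lee_fin fineK ?f_chi_fin //; apply: le_trans UX2 _; exact: xi_le_f_chi.
have F2W : W * expR p2 <= F2.
  rewrite leNgt; apply/negP => h; pose U := (F2 / expR p2 + W) / 2.
  have e20 := expR_gt0 p2.
  have FW : F2 / expR p2 < W by rewrite ltr_pdivrMr.
  have FU : 0 < F2 / expR p2 by rewrite divr_gt0.
  have := key U; rewrite -ler_pdivlMr // => /(_ _).
  have -> : 0 < U < W by rewrite /U; lra.
  by move=> /(_ isT); rewrite /U; lra.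
have p1q1 : p1 < q1.
  apply: kf_mono => //.
  rewrite -(ltr_pM2l F10) F1E (value_kf _ _ _ W0 p10 p1E).
  rewrite -(value_kf _ _ _ V0 q10 q1E) -F1E ltr_pM2r //; exact: kf_gt0.
have p2p1 : p2 < p1.
  by apply: Hf_mono => //; rewrite -(ltr_pM2l W0) p1E p2E.
(* The logarithmic form of the ratio inequality for the curves of [W] and [V]. Since [Hf (expR q2) *
   Hf (expR p1) = Hf (expR q1) * Hf (expR p2)], log-concavity with the shift [q1 - p1] excludes
   [p2 + (q1 - p1) <= q2]. *)
have gap : p1 + q2 < p2 + q1.
  rewrite ltNge; apply/negP => h.
  have g0 : 0 < q1 - p1 by rewrite subr_gt0.
  have := @Hf_log_concave R p1 p2 (q1 - p1); rewrite p20 p2p1 => /(_ isT g0).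
  rewrite [p1 + _]addrC subrK.
  have le2 : Hf (expR (p2 + (q1 - p1))) <= Hf (expR q2).
    by apply: Hf_nondecreasing; apply/andP; split; lra.
  apply/negP; rewrite -leNgt; apply: (@le_trans _ _ (Hf (expR q2) * Hf (expR p1))).
    by rewrite ler_pM2r.
  rewrite -(ler_pM2l V0) -(ler_pM2l W0).
  rewrite [leLHS](_ : _ = V * Hf (expR q2) * (W * Hf (expR p1))); last by ring.
  rewrite [leRHS](_ : _ = V * Hf (expR q1) * (W * Hf (expR p2))); last by ring.
  by rewrite q2E p1E q1E p2E mulrC.
apply: (@lt_le_trans _ _ (W * expR p2 / (V * expR q2))); last first.
  by rewrite ler_pM2r // invr_gt0 mulr_gt0 // expR_gt0.
rewrite F1E ltr_pdivrMr ?mulr_gt0 ?expR_gt0 // [ltRHS]mulrAC ltr_pdivlMr ?mulr_gt0 ?expR_gt0 //.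
rewrite [ltLHS](_ : _ = W * V * (expR p1 * expR q2)); last by ring.
rewrite [ltRHS](_ : _ = W * V * (expR p2 * expR q1)); last by ring.
by rewrite (ltr_pM2l (mulr_gt0 W0 V0)) -(expRD p1) -(expRD p2) ltr_expR.
Qed.

End comparison.

(** * Continuity in [t], and strict inequality for some [t] *)

Section phase_transition.
Context {R : realType} {d : nat} {N : d.-tuple R -> R} (HN : is_norm N).

Notation v := (leb d (nball N (vzero R d) 2^-1)).
Hypothesis voo : (v < +oo)%E.
Notation V := (fine v).

(** Each time parameter is tested at the minimiser of the other; for the upper bound, multiplying by
    [t / s >= 1] turns [t^-1] into [s^-1] and can only increase the nonnegative [Phi]. *)
Lemma xi_antitone (phi : d.-tuple R -> R) (s t : R) : feasible N phi -> 0 < s <= t ->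
  (xi phi t <= xi phi s <= (t / s)%:E * xi phi t)%E.
Proof.
move=> fphi /andP[s0 st]; have t0 := lt_le_trans s0 st.
have [[_ xi0]|h] := feasible_xi HN voo fphi; first by rewrite !xi0 mule0 lexx.
have [X [a [-> a0 aX hX _]]] := h t t0; have [Y [b [-> b0 bY hY _]]] := h s s0.
have ts : t^-1 <= s^-1 by rewrite lef_pV2 ?posrE.
rewrite -EFinM !lee_fin; apply/andP; split.
  by rewrite -(ler_pM2l b0) bY (le_trans (hX b b0)) // lerD2r.
rewrite -(ler_pM2l a0); apply: (le_trans (hY a a0)).
rewrite mulrCA aX mulrDr; apply: lerD.
  by rewrite mulrAC divff ?gt_eqF // mul1r.
have P0 := feasible_Phi_ge0 HN voo fphi (ltW a0).
by rewrite ler_peMl // ler_pdivlMr // mul1r.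
Qed.

Lemma f_chi_antitone (s t : R) : 0 < s <= t ->
  (f_chi N t <= f_chi N s <= (t / s)%:E * f_chi N t)%E.
Proof.
move=> st; have /andP[s0 st'] := st; apply/andP; split.
  apply: ge_ereal_sup => _ [phi fphi <-].
  by have /andP[h _] := xi_antitone fphi st; apply: (le_trans h); exact: xi_le_f_chi.
apply: ge_ereal_sup => _ [phi fphi <-]; have /andP[_ h] := xi_antitone fphi st.
apply: (le_trans h); apply: lee_wpmul2l; last exact: xi_le_f_chi.
by rewrite lee_fin divr_ge0 ?(ltW s0) // (le_trans _ st') // ltW.
Qed.

Lemma continuous_of_antitone (f : R -> R) :
  (forall s t, 0 < s <= t -> f t <= f s <= t / s * f t) -> (forall t, 0 < t -> 0 <= f t) ->
  forall t, 0 < t -> {for t, continuous f}.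
Proof.
move=> fst f0 t t0; apply/cvgrPdist_le => e e0.
have ft0 := f0 t t0.
pose D := f t + 1; have D0 : 0 < D by rewrite /D; lra.
(* The first entry keeps [t <= 2 * u]; this accounts for the 2 in the second, because for [u < t]
   the estimate is divided by [u]. *)
pose r := Num.min (t / 2) (t * e / (2 * D)).
have r0 : 0 < r by rewrite lt_min !divr_gt0 // ?mulr_gt0.
near=> u.
have : `|t - u| < r by near: u; exact: (@cvgr_dist_lt _ _ _ (nbhs t) _ id).
rewrite lt_min => /andP[tu1 tu2].
have u2 : t / 2 <= u by move: tu1; rewrite ltr_norml; lra.
have u0 : 0 < u by lra.
have tu3 : `|t - u| * (2 * D) <= t * e by rewrite -ler_pdivlMr ?mulr_gt0 // ltW.
have fD : f t <= D by rewrite /D; lra.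
have [tu|ut] := leP t u.
  have := fst t u; rewrite t0 tu => /(_ isT) /andP[h1 h2].
  rewrite ger0_norm ?subr_ge0 //.
  have h3 : t * f t <= u * f u.
    by rewrite -ler_pdivlMl // mulrA [t^-1 * u]mulrC.
  have h4 : (u - t) * f u <= (u - t) * D.
    by apply: ler_wpM2l; [rewrite subr_ge0|exact: le_trans h1 fD].
  rewrite ler0_norm ?subr_le0 // in tu3.
  rewrite -(ler_pM2l t0); nra.
have := fst u t; rewrite u0 ltW // => /(_ isT) /andP[h1 h2].
rewrite distrC ger0_norm ?subr_ge0 //.
have h3 : u * f u <= t * f t.
  by rewrite -ler_pdivlMl // mulrA [u^-1 * t]mulrC.
have h4 : (t - u) * f t <= (t - u) * D.
  by apply: ler_wpM2l => //; rewrite subr_ge0 ltW.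
rewrite ger0_norm ?subr_ge0 ?(ltW ut) // in tu3.
rewrite -(ler_pM2l u0).
have : t * e <= 2 * (u * e) by nra.
by lra.
Unshelve. all: by end_near. Qed.

Lemma continuous_f_chi t : 0 < t -> {for t, continuous (fun t => fine (f_chi N t))}.
Proof.
apply: continuous_of_antitone => [s u /andP[s0 su]|u u0]; last first.
  apply: fine_ge0; apply: le_trans (f_omega_le_f_chi HN u).
  exact: (xi_ge0 HN voo (feasible_half_ball HN) u0).
have u0 := lt_le_trans s0 su.
have := @f_chi_antitone s u; rewrite s0 su => /(_ isT).
by rewrite -(fineK (f_chi_fin HN voo s0)) -(fineK (f_chi_fin HN voo u0)) -EFinM !lee_fin.
Qed.

Lemma continuous_f_omega t : 0 < t -> {for t, continuous (fun t => fine (f_omega N t))}.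
Proof.
apply: continuous_of_antitone => [s u /andP[s0 su]|u u0]; last first.
  by rewrite ltW // f_omega_gt0.
have u0 := lt_le_trans s0 su.
have := @xi_antitone _ s u (feasible_half_ball HN); rewrite s0 su => /(_ isT).
rewrite -!/(f_omega N _).
by rewrite -(fineK (f_omega_fin HN voo s0)) -(fineK (f_omega_fin HN voo u0)) -EFinM !lee_fin.
Qed.

(** Take the constant [1 / packnum N K] on the cube of side [K / 2]. A well-spread set in that cube,
    doubled, is an admissible packing, which gives feasibility; the integral exceeds [V] exactly
    when the ratio at [K] is below 1. *)
Lemma feasible_large_integral (delta : R) : delta < 1 ->
  pack_ratio N x @[x --> +oo] --> delta%:E ->
  exists2 phi, feasible N phi & V < rint phi.
Proof.
move=> d1 cd; have V0 := fine_ball_gt0 HN voo.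
have [K [K0 rK]] : exists K, 0 < K /\ (pack_ratio N K < 1%:E)%E.
  have big : \forall K \near +oo, 0 < K :> R by apply: nbhs_pinfty_gt; exact: num_real.
  have d1' : (delta%:E < 1%:E)%E by rewrite lte_fin.
  exact: filter_ex (filterI big (cd _ (open_ereal_lt' d1'))).
have P1 : (1 <= packnum N K)%E by exact: packnum_ge1.
have Kd : 0 < K ^+ d by rewrite exprn_gt0.
have c0 : 0 < 2 ^+ d * V / K ^+ d by rewrite divr_gt0 // mulr_gt0 // exprn_gt0.
move: rK; rewrite /pack_ratio vol_unitB // -(fine_ballE voo) -EFinM -muleA -EFinM.
rewrite muleC -lte_pdivlMl // mule1 => rK.
have Pfin : packnum N K \is a fin_num.
  rewrite ge0_fin_numE ?(le_trans _ P1) //.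
  by apply: lt_le_trans rK _; rewrite leey.
set p := fine (packnum N K).
have pE : packnum N K = p%:E by rewrite fineK.
have p1 : 1 <= p by rewrite -lee_fin -pE.
have p0 : 0 < p by lra.
rewrite pE lte_fin in rK.
pose Q := cube d 0 (K / 2).
have mQ : measurable Q by exact: measurable_cube.
have K20 : 0 < K / 2 by rewrite divr_gt0.
exists (fun x => p^-1 * \1_Q x).
  apply/feasibleP; split.
  - by apply: measurable_funM => //; exact: measurable_indic.
  - by move=> x; rewrite mulr_ge0 // invr_ge0 ltW.
  move=> s us ws; rewrite -mulr_sumr.
  rewrite ler_pdivrMl // mulr1.
  have -> : \sum_(x <- s) \1_Q x = (size [seq x <- s | x \in Q])%:R :> R.
    by rewrite size_filter -sum1_count natr_sum [RHS]big_mkcond; apply: eq_bigr => x _; rewrite indicE; case: (x \in Q).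
  rewrite -lee_fin -pE; apply: ereal_sup_ubound.
  exists [seq vscale 2 c | c <- [seq x <- s | x \in Q]]; last by rewrite size_map.
  have -> : K = 2 * (K / 2) by field.
  apply: spread_packing => //; split.
  - exact: filter_uniq.
  - by move=> a b /=; rewrite !mem_filter => /andP[_ sa] /andP[_ sb]; exact: ws.
  - by move=> c; rewrite mem_filter => /andP[/set_mem].
have QE : leb d Q = ((K / 2) ^+ d)%:E by rewrite /Q leb_cube ?subr0 // ltW.
rewrite /rint; under eq_integral do rewrite EFinM.
rewrite ge0_integralZl_EFin //; last 2 first.
- exact/measurable_EFinP/measurable_indic.
- by rewrite invr_ge0 ltW.
rewrite (_ : (\int[leb d]_x (\1_Q x)%:E)%E = ((K / 2) ^+ d)%:E); last first.
  by rewrite -QE; exact: integral_indicT.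
rewrite -EFinM [ltRHS]/= mulrC ltr_pdivlMr // exprMn exprVn.
have p2 : 0 < 2 ^+ d :> R by rewrite exprn_gt0.
rewrite ltr_pdivlMr //; move: rK; rewrite invf_div ltr_pdivlMr ?mulr_gt0 //.
by congr (_ < _); ring.
Qed.

Lemma f_omega_lt_f_chi (delta : R) : delta < 1 ->
  pack_ratio N x @[x --> +oo] --> delta%:E ->
  exists2 t, 0 < t & (f_omega N t < f_chi N t)%E.
Proof.
move=> d1 cd; have V0 := fine_ball_gt0 HN voo.
have [phi fphi Vphi] := feasible_large_integral d1 cd.
(* The parameter [t] is chosen so that the half ball has value [V * w]; as [w < rint phi / V], this
   is below [rint phi], a lower bound for [xi phi t]. *)
pose w := (1 + rint phi / V) / 2.
have Vr : 1 < rint phi / V by rewrite ltr_pdivlMr // mul1r.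
have w1 : 1 < w by rewrite /w; lra.
have q0 : 0 < ln w by rewrite ln_gt0.
have H0 := Hf_gt0 q0.
pose t := (V * Hf (expR (ln w)))^-1.
have t0 : 0 < t by rewrite invr_gt0 mulr_gt0.
exists t => //.
rewrite (f_omegaE HN voo t0 q0); last by rewrite invrK.
rewrite lnK ?posrE; last by lra.
apply: lt_le_trans (xi_le_f_chi t fphi).
have [[r0 _]|/(_ t t0)[X [s [-> _ _ _ phiX]]]] := feasible_xi HN voo fphi.
  by move: Vphi; rewrite r0 ltNge (ltW V0).
rewrite lte_fin; apply: lt_le_trans phiX.
by rewrite mulrC -ltr_pdivlMr // /w; lra.
Qed.

End phase_transition.

Theorem theorem1p3 (R : realType) (d : nat) (N : d.-tuple R -> R) :
  (0 < d)%N -> is_norm N ->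
  (* 1. delta = 1 *)
  (pack_ratio N x @[x --> +oo] --> 1%E ->
     forall t : R, 0 < t -> f_chi N t = f_omega N t) /\
  (* 2. delta < 1 *)
  (forall delta : R, delta < 1 -> pack_ratio N x @[x --> +oo] --> delta%:E ->
     exists t0 : R, 0 < t0 /\
       (forall t : R, 0 < t <= t0 -> f_chi N t = f_omega N t) /\
       (forall t : R, t0 <= t -> f_chi N t \is a fin_num) /\
       {within [set t | t0 <= t],
          continuous (fun t => fine (f_chi N t) / fine (f_omega N t))} /\
       (forall t1 t2 : R, t0 <= t1 -> t1 < t2 ->
          fine (f_chi N t1) / fine (f_omega N t1) <
          fine (f_chi N t2) / fine (f_omega N t2))).
Proof.
move=> _ HN; split=> [c1 t t0|delta d1 cd].
  have voo := finite_ball HN c1.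
  have [q [q0 qE _]] := f_omega_root HN voo t0.
  apply: (f_chi_eq_f_omega HN voo t0 q0 qE) => phi fphi.
  have [mphi phi0 bphi] := (feasibleP phi).1 fphi.
  have phi01 := feasible_01 fphi; have phioo := feasible_lty HN voo fphi.
  apply: le_trans (Phi_chord mphi phi01 phioo (ltW q0)) _.
  apply: ler_wpM2r; first by have := expR_ge1Dx q; lra.
  rewrite -lee_fin (fine_ballE voo) (rintE mphi phi01 phioo); last exact: dominated_phi.
  exact: feasible_integral_le.
have voo := finite_ball HN cd.
(* The threshold will be [sup T]; it remains to see that [T] is a nonempty bounded initial segment
   containing its supremum. *)
pose T := [set t : R | 0 < t /\ f_chi N t = f_omega N t].
have chi_fin := f_chi_fin HN voo; have omega_fin := f_omega_fin HN voo.
have omega_gt0 := f_omega_gt0 HN voo.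
have le_chi t : 0 < t -> fine (f_omega N t) <= fine (f_chi N t).
  by move=> t0; apply: fine_le; [exact: omega_fin|exact: chi_fin|exact: f_omega_le_f_chi].
have notT t : 0 < t -> ~ T t -> (f_omega N t < f_chi N t)%E.
  move=> t0 nT; rewrite lt_neqAle f_omega_le_f_chi // andbT; apply/eqP => e.
  by apply: nT; split.
(* A ratio above 1 at [s] would only grow, so it could not be 1 at [t]. *)
have down s t : 0 < s <= t -> T t -> T s.
  move=> /andP[s0]; rewrite le_eqVlt => /orP[/eqP ->//|st] [t0 tT].
  apply: contrapT => /(notT s s0) h.
  have := ratio_increasing HN voo (t1 := s) (t2 := t); rewrite s0 st => /(_ isT h).
  rewrite tT divff ?gt_eqF ?omega_gt0 // ltr_pdivrMr ?omega_gt0 // mul1r ltNge.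
  by rewrite le_chi.
have [s s0 sP] := Phi_le_half_ball HN voo.
have V0 := fine_ball_gt0 HN voo.
pose ts := (fine (leb d (nball N (vzero R d) 2^-1)) * Hf (expR s))^-1.
have ts0 : 0 < ts by rewrite invr_gt0 mulr_gt0 // Hf_gt0.
have tsT : T ts.
  by split => //; apply: (f_chi_eq_f_omega HN voo ts0 s0 _ sP); rewrite invrK.
have [tb tb0 tbP] := f_omega_lt_f_chi HN voo d1 cd.
have ubT : ubound T tb.
  move=> t tT; rewrite leNgt; apply/negP => tbt.
  have [_ e] : T tb by apply: down tT; rewrite tb0 ltW.
  by move: tbP; rewrite e ltxx.
have hsT : has_sup T by split; [exists ts|exists tb].
have supT : ts <= sup T by apply: sup_upper_bound.
have sup0 : 0 < sup T by exact: lt_le_trans supT.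
have below t : 0 < t -> t < sup T -> T t.
  move=> t0 tT; have /sup_adherent/(_ hsT) : 0 < sup T - t by rewrite subr_gt0.
  case=> u uT; rewrite subKr => tu; apply: down uT; by rewrite t0 ltW.
have Tsup : T (sup T).
  apply: contrapT => /(notT _ sup0).
  rewrite -(fineK (chi_fin _ sup0)) -(fineK (omega_fin _ sup0)) lte_fin.
  set F := fine (f_chi N _); set W := fine (f_omega N _) => WF.
  have W0 : 0 < W by exact: omega_gt0.
  have F0 : 0 < F by exact: lt_trans WF.
  have WF1 : W / F < 1 by rewrite ltr_pdivrMr // mul1r.
  have WF0 : 0 < W / F by exact: divr_gt0.
  (* A point of [T] so close to [sup T] that [sup T / t < F / W]; then [F <= f_chi t = f_omega t <=
     (sup T / t) * W < F]. *)
  pose t := sup T * ((1 + W / F) / 2).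
  have t0 : 0 < t by rewrite mulr_gt0 //; lra.
  have tsup : t < sup T by rewrite gtr_pMr //; lra.
  have [_ tE] := below t t0 tsup.
  have st : 0 < t <= sup T by rewrite t0 ltW.
  have /andP[h1 _] := f_chi_antitone HN voo st.
  have /andP[_ h2] := xi_antitone HN voo (feasible_half_ball HN) st.
  have := le_trans h1 (eq_ind_r (fun x => (x <= (sup T / t)%:E * f_omega N (sup T))%E) h2 tE).
  rewrite -(fineK (chi_fin _ sup0)) -(fineK (omega_fin _ sup0)) -EFinM lee_fin -/F -/W.
  apply/negP; rewrite -ltNge mulrAC ltr_pdivrMr // /t mulrCA ltr_pM2l //.
  rewrite -ltr_pdivrMl // mulrC; lra.
exists (sup T); split => //; split; first by move=> t tT; case: (down _ _ tT Tsup).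
split; first by move=> t tT; apply: chi_fin; exact: lt_le_trans tT.
split.
  apply: continuous_in_subspaceT => t /set_mem /= tT.
  have t0 : 0 < t by exact: lt_le_trans tT.
  apply: cvgM; first exact: continuous_f_chi.
  apply: cvgV; first by rewrite gt_eqF ?omega_gt0.
  exact: continuous_f_omega.
(* The growth lemma needs a ratio above 1 at [t1], so the endpoint [t1 = sup T] is separate: the
   ratio is 1 there and exceeds 1 at any later [t2], which is outside [T]. *)
move=> t1 t2; rewrite le_eqVlt => /orP[/eqP <-|t1T] t12; last first.
  have t10 := lt_trans sup0 t1T.
  apply: (ratio_increasing HN voo); first by rewrite t10.
  apply: notT => // tT; have := sup_upper_bound hsT tT; by rewrite leNgt t1T.
have t20 := lt_trans sup0 t12; case: Tsup => _ ->.
rewrite divff ?gt_eqF ?omega_gt0 // ltr_pdivlMr ?omega_gt0 // mul1r.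
rewrite -lte_fin (fineK (chi_fin _ t20)) (fineK (omega_fin _ t20)).
apply: (notT _ t20) => tT.
by have := sup_upper_bound hsT tT; rewrite leNgt t12.
Qed.
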